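(* Let $d\ge 2$, $1\le m<d$, $n\ge 1$ be integers, and let $\nu\ge 0$, $c>0$, $t>0$ be real. Let $\underline{\mathbf X}_m^d(t)=(X_1(t),\dots,X_m(t))$ be the projection onto $\mathbb{R}^m$ of the random flight in $\mathbb{R}^d$ with parameter $\nu$, speed $c$ and $n$ changes of direction in $[0,t]$ (as defined in the context). Then for every $\underline\alpha_m\in\mathbb{R}^m$ (at $\underline\alpha_m=0$ the right-hand side is understood as its limit), $$E\left\{e^{i\langle\underline\alpha_m,\underline{\mathbf X}_m^d(t)\rangle}\right\}=\frac{2^{\frac{n+1}{2}(2\nu+d-1)-\frac12}\,\Gamma\!\left(\frac{n+1}{2}(2\nu+d-1)+\frac12\right)}{(ct\|\underline\alpha_m\|)^{\frac{n+1}{2}(2\nu+d-1)-\frac12}}\;J_{\frac{n+1}{2}(2\nu+d-1)-\frac12}(ct\|\underline\alpha_m\|).$$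
   Context: Here $\langle\cdot,\cdot\rangle$ and $\|\cdot\|$ are the Euclidean scalar product and norm, and $J_\mu(x)=\sum_{k=0}^\infty\frac{(-1)^k}{k!\,\Gamma(k+\mu+1)}\left(\frac x2\right)^{2k+\mu}$ is the Bessel function. Random flight. A particle starts at the origin of $\mathbb{R}^d$, moves with constant speed $c>0$, and changes direction exactly $n$ times in $[0,t]$. The durations of the $n+1$ straight segments are $\tau_1,\dots,\tau_{n+1}>0$ with $\tau_{n+1}=t-\sum_{j=1}^n\tau_j$, and $(\tau_1,\dots,\tau_n)$ has the rescaled Dirichlet density $$f_{d,\nu}(\tau_1,\dots,\tau_n)=\frac{\Gamma((n+1)(2\nu+d-1))}{(\Gamma(2\nu+d-1))^{n+1}}\,\frac{\prod_{k=1}^{n+1}\tau_k^{2\nu+d-2}}{t^{(n+1)(2\nu+d-1)-1}}$$ on $\{\tau_j>0\ (1\le j\le n),\ \sum_{j=1}^n\tau_j<t\}$. The angle vectors $(\theta_{1,k},\dots,\theta_{d-2,k},\phi_k)$, $k=1,\dots,n+1$, are independent of each other and of the times, and each has density $$g_{d,\nu}(\theta_1,\dots,\theta_{d-2},\phi)=\frac{\Gamma(\nu+d/2)}{2\pi^{\frac{d-1}{2}}\Gamma(\nu+1/2)}\sin^{2\nu+d-2}\theta_1\,\sin^{2\nu+d-3}\theta_2\cdots\sin^{2\nu+1}\theta_{d-2}\,|\sin\phi|^{2\nu}$$ on $\theta_j\in[0,\pi]$ $(1\le j\le d-2)$, $\phi\in[0,2\pi]$ (for $d=2$ there is only the angle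 $\phi$). The projection $\underline{\mathbf X}_m^d(t)=(X_1(t),\dots,X_m(t))$, $1\le m<d$, consists of the first $m$ coordinates of the particle's position at time $t$, namely, with the convention $\theta_{d-1,k}=\phi_k$, $$X_i(t)=c\sum_{k=1}^{n+1}\tau_k\,\sin\theta_{1,k}\cdots\sin\theta_{i-1,k}\,\cos\theta_{i,k},\qquad 1\le i\le m$$ (so $X_1(t)=c\sum_{k=1}^{n+1}\tau_k\cos\theta_{1,k}$). *)

(* Defs.v *)
From HB Require Import structures.
From mathcomp Require Import all_boot all_order all_algebra.
From mathcomp Require Import all_classical all_reals all_analysis.
From mathcomp Require Import complex.

Set Implicit Arguments.
Unset Strict Implicit.
Unset Printing Implicit Defensive.

Import Order.TTheory GRing.Theory Num.Theory.
Import numFieldNormedType.Exports.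

Local Open Scope classical_set_scope.
Local Open Scope ring_scope.

(* Euler's integral: it represents the Gamma function for 0 < x only; outside
   that range the value is meaningless. *)
Definition Gamma {R : realType} (x : R) : R :=
  \int[@lebesgue_measure R]_(s in [set` `]0, +oo[]) (s `^ (x - 1) * expR (- s)).

(* For 0 < x and -1 < mu, so that every Gamma argument is positive. *)
Definition besselJ {R : realType} (mu x : R) : R :=
  limn (series (fun k : nat =>
    (-1) ^+ k / (k`!%:R * Gamma (k%:R + mu + 1)) * (x / 2) `^ (2 * k%:R + mu))).

(* The built-in norm of a row vector is the sup norm, not the Euclidean one. *)
Definition dot {R : realType} {m : nat} (u v : 'rV[R]_m) : R :=
  \sum_(i < m) u 0 i * v 0 i.

Definition enorm {R : realType} {m : nat} (u : 'rV[R]_m) : R :=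
  Num.sqrt (dot u u).

(* Integral of a nonnegative measurable function on R^n with respect to the
   n-dimensional Lebesgue measure, as the iterated integral (Tonelli). *)
Fixpoint iint {R : realType} {n : nat} : (n.-tuple R -> \bar R) -> \bar R :=
  match n with
  | 0 => fun f => f [tuple]
  | n'.+1 => fun f =>
      (\int[@lebesgue_measure R]_x iint (fun v => f [tuple of x :: v]))%E
  end.

Definition has_density {disp : measure_display} {Omega : measurableType disp}
    {R : realType} {P : probability Omega R} {n : nat}
    (X : {RV P >-> n.-tuple R}) (f : n.-tuple R -> R) : Prop :=
  forall A : set (n.-tuple R), measurable A ->
    distribution P X A = iint (fun v => (f v * \1_A v)%:E).

Definition cexpectation {disp : measure_display}
    {Omega : measurableType disp} {R : realType} (P : probability Omega R)
    (Z : Omega -> R[i]) : R[i] :=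
  Complex (fine 'E_P[fun w => complex.Re (Z w)])
          (fine 'E_P[fun w => complex.Im (Z w)]).

Definition expi {R : realType} (x : R) : R[i] := Complex (cos x) (sin x).

Definition charfun {disp : measure_display} {Omega : measurableType disp}
    {R : realType} (P : probability Omega R) {m : nat}
    (X : Omega -> 'rV[R]_m) (alpha : 'rV[R]_m) : R[i] :=
  cexpectation P (fun w => expi (dot alpha (X w))).

Definition durations {R : realType} {n : nat} (t : R) (tau : n.-tuple R) :
    n.+1.-tuple R :=
  [tuple of rcons tau (t - \sum_(j < n) tnth tau j)].

Definition times_density {R : realType} (d n : nat) (nu t : R)
    (tau : n.-tuple R) : R :=
  let a := 2 * nu + d%:R - 1 in
  if [forall j : 'I_n, 0 < tnth tau j] && (\sum_(j < n) tnth tau j < t) then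
    Gamma (n.+1%:R * a) / Gamma a ^+ n.+1
    * ((\prod_(k < n.+1) tnth (durations t tau) k `^ (2 * nu + d%:R - 2))
       / t `^ (n.+1%:R * a - 1))
  else 0.

(* An angle vector (theta_1, ..., theta_(d-2), phi) is stored 0-based:
   theta_(j+1) is the entry j and phi = theta_(d-1) is the entry d - 2. *)
Definition angle_density {R : realType} (d : nat) (nu : R)
    (a : (d.-1).-tuple R) : R :=
  if [forall j : 'I_(d - 2), 0 <= a`_j <= pi] && (0 <= a`_(d - 2) <= 2 * pi)
  then
    Gamma (nu + d%:R / 2) / (2 * pi `^ ((d%:R - 1) / 2) * Gamma (nu + 1 / 2))
    * (\prod_(j < d - 2) sin a`_j `^ (2 * nu + d%:R - 2 - j%:R))
    * `|sin a`_(d - 2)| `^ (2 * nu)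
  else 0.

Record random_flight {disp : measure_display} {Omega : measurableType disp}
    {R : realType} {P : probability Omega R} (d n : nat) (nu t : R)
    (tau : {RV P >-> n.-tuple R})
    (theta : 'I_n.+1 -> {RV P >-> (d.-1).-tuple R}) : Prop := RandomFlight {
  flight_times : has_density tau (times_density d nu t);
  flight_angles : forall k, has_density (theta k) (angle_density nu);
  (* some of the sets may be the full space, so this covers all subfamilies *)
  flight_indep : forall (A : set (n.-tuple R))
      (B : 'I_n.+1 -> set ((d.-1).-tuple R)),
    measurable A -> (forall k, measurable (B k)) ->
    P (tau @^-1` A `&` [set w | forall k, B k (theta k w)])
    = (P (tau @^-1` A) * \prod_(k < n.+1) P (theta k @^-1` B k))%E }.

Definition flight_projection {Omega : Type} {R : realType} (d m n : nat)
    (c t : R) (tau : Omega -> n.-tuple R)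
    (theta : 'I_n.+1 -> Omega -> (d.-1).-tuple R) (w : Omega) : 'rV[R]_m :=
  \row_(i < m) (c * \sum_(k < n.+1) tnth (durations t (tau w)) k
    * (\prod_(j < i) sin (theta k w)`_j) * cos (theta k w)`_i).

Definition flight_charfun {R : realType} (d n : nat) (nu c t r : R) : R :=
  let s := n.+1%:R / 2 * (2 * nu + d%:R - 1) in
  2 `^ (s - 1 / 2) * Gamma (s + 1 / 2) / (c * t * r) `^ (s - 1 / 2)
  * besselJ (s - 1 / 2) (c * t * r).

(* Main.v *)
Require Import Defs.
From HB Require Import structures.
From mathcomp Require Import all_boot all_order all_algebra.
From mathcomp Require Import all_classical all_reals all_analysis.
From mathcomp Require Import measurable_realfun complex.
From mathcomp Require Import ring lra.
Set Implicit Arguments.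
Unset Strict Implicit.
Unset Printing Implicit Defensive.
Import Order.TTheory GRing.Theory Num.Theory.
Import numFieldNormedType.Exports.
Local Open Scope classical_set_scope.
Local Open Scope ring_scope.

(** The characteristic function is computed from the moments of the projection.
    Write [a = 2 nu + d - 1] and let [Y] be the scalar product of [alpha] with
    the position at time [t]. Then [Y = c * \sum_k tau_k W_k], where [W_k] is the
    scalar product of [alpha] with the direction of the [k]-th segment, and [Y]
    is almost surely bounded, so that [E cos Y] and [E sin Y] are the sums of
    their Taylor series integrated term by term. It remains to know [E Y^N]. All
    the moments that occur have the same shape: writing [(x)_n] for the rising
    factorial, put

      [mom h r N = 0] if [N] is odd, [(1/2)_M / (h)_M * r^M] if [N = 2 M].

    - Direction of one segment. The recursion
      [direction al (x :: s) = al 0 * cos x + sin x * direction (shifted al) s]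
      and the integrals of [cos^i sin^l |sin|^q] give, by induction on the number
      of angles, [E W_k^N = mom ((a + 1) / 2) |alpha|^2 N]
      ([angle_weight_moments], [angle_moment]). The binomial sum closes up
      because ['C(2M, 2i) (1/2)_i (1/2)_(M-i) = 'C(M, i) (1/2)_M]
      ([mom_trig]).

    - Durations. Each further segment contributes a Beta integral, and
      [E (\sum_k tau_k W_k)^N = t^N * mom (((n+1) a + 1) / 2) |alpha|^2 N]
      ([time_weight_moments], [flight_moment]); here the sum closes up by the
      Vandermonde identity for rising factorials ([mom_dirichlet]).

    - Series. With [h = ((n+1) a + 1) / 2], the resulting series
      [\sum_k (-1)^k / (k! (h)_k) (c t |alpha| / 2)^(2k)] is the normalised
      Bessel function of order [h - 1], by [Gamma (k + h) = (h)_k Gamma h]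
      ([Gamma_poch], [besselJE]).

    Only ratios of trigonometric and Beta integrals are ever needed: they follow
    from integrating the derivative of a function that vanishes at both ends, and
    the normalising constants of the densities cancel because a density has total
    mass [1] ([density_integral]). The limit at [alpha = 0] comes from
    [1 - y^2 <= cos y <= 1] and the second moment. *)

(** * Rising factorials and the moment sequences *)

(** The rising factorial [x (x + 1) ... (x + n - 1)]. *)
Definition poch {R : realType} (x : R) (n : nat) : R := \prod_(i < n) (x + i%:R).

Section poch.
Context {R : realType}.
Implicit Types (x y h r a : R).

Lemma poch0 x : poch x 0 = 1.
Proof. by rewrite /poch big_ord0. Qed.

Lemma pochS x n : poch x n.+1 = poch x n * (x + n%:R).
Proof. by rewrite /poch big_ord_recr. Qed.

Lemma poch_gt0 x n : 0 < x -> 0 < poch x n.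
Proof. by move=> x0; rewrite prodr_gt0// => i _; rewrite ltr_wpDr. Qed.

Lemma poch_neq0 x n : 0 < x -> poch x n != 0.
Proof. by move=> x0; rewrite gt_eqF// poch_gt0. Qed.

Lemma poch_double x n :
  poch x n.*2 = 4 ^+ n * poch (x / 2) n * poch ((x + 1) / 2) n.
Proof.
elim: n => [|n IH]; first by rewrite !poch0 expr0 !mulr1.
rewrite doubleS !pochS IH exprS -addn1 natrD -muln2 natrM.
by field.
Qed.

Lemma poch_half_fact n : (n.*2)`!%:R = 4 ^+ n * n`!%:R * poch (1 / 2 : R) n.
Proof.
elim: n => [|n IH]; first by rewrite poch0 expr0 !mulr1.
rewrite doubleS !factS !natrM IH pochS exprS -muln2 -!natr1 natrM.
by field.
Qed.

Lemma poch_vandermonde x y n :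
  \sum_(i < n.+1) 'C(n, i)%:R * poch x i * poch y (n - i) = poch (x + y) n.
Proof.
elim: n => [|n IH].
  by rewrite big_ord_recl big_ord0 subnn bin0 !poch0 !mulr1 addr0.
rewrite pochS -IH mulr_suml.
under [RHS]eq_bigr => i _.
  have -> : x + y + n%:R = (x + i%:R) + (y + (n - i)%:R).
    by rewrite natrB -1?ltnS//; ring.
  rewrite mulrDr.
  rewrite [X in X + _](_ : _ = 'C(n, i)%:R * poch x i.+1 * poch y (n - i));
    last by rewrite pochS; ring.
  rewrite [X in _ + X](_ : _ = 'C(n, i)%:R * poch x i * poch y (n.+1 - i));
    last by rewrite subSn -1?ltnS// pochS; ring.
  over.
rewrite big_split/= [X in _ = X + _]big_ord_recr/=.
rewrite [X in _ = _ + X]big_ord_recl/=.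
rewrite big_ord_recl big_ord_recr/= !bin0 !binn !subnn subn0.
rewrite [LHS](_ : _ = (\sum_(i < n) 'C(n.+1, bump 0 i)%:R * poch x (bump 0 i) *
  poch y (n.+1 - bump 0 i)) + (poch y n.+1 + poch x n.+1)); last first.
  by rewrite !poch0 /bump/= ?add1n ?binn ?subnn ?poch0 ?mulr1 ?mul1r; ring.
rewrite [RHS](_ : _ = (\sum_(i < n) 'C(n, i)%:R * poch x i.+1 * poch y (n - i) +
  \sum_(i < n) 'C(n, bump 0 i)%:R * poch x (bump 0 i) *
  poch y (n.+1 - bump 0 i)) + (poch y n.+1 + poch x n.+1)); last first.
  by rewrite !poch0; ring.
congr (_ + _); rewrite -big_split/=; apply: eq_bigr => i _.
rewrite /bump/= add1n subSS binS natrD; ring.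
Qed.

(** The [N]-th moment of [u * sqrt r] when [u] has a density proportional to
    [(1 - u^2)^(h - 3/2)] on [-1, 1]; the argument [r] is a squared norm, so that
    no square root is needed. *)
Definition mom h r (N : nat) : R :=
  if odd N then 0 else poch (1 / 2) N./2 / poch h N./2 * r ^+ N./2.

Lemma mom_odd h r N : odd N -> mom h r N = 0.
Proof. by rewrite /mom => ->. Qed.

Lemma mom_double h r N : mom h r N.*2 = poch (1 / 2) N / poch h N * r ^+ N.
Proof. by rewrite /mom odd_double doubleK. Qed.

Lemma mom0 h r : mom h r 0 = 1.
Proof. by rewrite /mom/= !poch0 divr1 mulr1. Qed.

Lemma sum_even (F : nat -> R) n : (forall i, odd i -> F i = 0) ->
  \sum_(i < n.*2.+1) F i = \sum_(i < n.+1) F i.*2.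
Proof.
move=> F0; elim: n => [|n IH]; first by rewrite !big_ord_recl !big_ord0.
rewrite doubleS big_ord_recr big_ord_recr/= IH [RHS]big_ord_recr/=.
by rewrite F0 ?addr0//= odd_double.
Qed.

(** Both sides equal [M! (1/2)_M / (i! (M - i)!)], by [poch_half_fact]. *)
Lemma bin_double_half M i : (i <= M)%N ->
  'C(M.*2, i.*2)%:R * poch (1 / 2) i * poch (1 / 2) (M - i) =
  'C(M, i)%:R * poch (1 / 2 : R) M.
Proof.
move=> iM; have fn0 k : k`!%:R != 0 :> R by rewrite pnatr_eq0 -lt0n fact_gt0.
have p0 k : poch (1 / 2 : R) k != 0 by apply: poch_neq0; lra.
have four k : (4 : R) ^+ k != 0 by rewrite expf_neq0// pnatr_eq0.
have E1 : 'C(M.*2, i.*2)%:R = (M.*2)`!%:R / ((i.*2)`!%:R * ((M - i).*2)`!%:R) :> R.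
  have := @bin_fact M.*2 i.*2; rewrite leq_double iM => /(_ isT).
  rewrite -doubleB => /(congr1 (fun n => n%:R : R)); rewrite !natrM => <-.
  by rewrite mulfK// mulf_neq0.
have E2 : 'C(M, i)%:R = M`!%:R / (i`!%:R * (M - i)`!%:R) :> R.
  have := bin_fact iM => /(congr1 (fun n => n%:R : R)); rewrite !natrM => <-.
  by rewrite mulfK// mulf_neq0.
rewrite E1 E2 !poch_half_fact.
rewrite (_ : 4 ^+ M = 4 ^+ i * 4 ^+ (M - i)); last by rewrite -exprD subnKC.
by field; rewrite ?fn0 ?p0 ?four.
Qed.

(** Adding one angle. [C i l] stands for the integral of
    [cos^i sin^l] against the weight of that angle and [K] for its total mass;
    [al] is the new coordinate and [r] the squared norm of the others. *)
Lemma mom_trig h al r K (C : nat -> nat -> R) (N : nat) :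
  1 / 2 < h ->
  (forall i l,
    C i.*2 l.*2 = K * (poch (1 / 2) i * poch (h - 1 / 2) l / poch h (i + l))) ->
  (forall i l, odd i -> C i l.*2 = 0) ->
  \sum_(i < N.+1) 'C(N, i)%:R * al ^+ i * C i (N - i)%N * mom (h - 1 / 2) r (N - i)
  = K * mom h (al ^+ 2 + r) N.
Proof.
move=> h0 Ceven Codd.
(* A product with [N] odd has an odd power of the cosine or an odd moment. *)
have [oN|eN] := boolP (odd N).
  rewrite mom_odd// mulr0 big1// => -[i iN _] /=.
  have [oi|ei] := boolP (odd i).
    have /even_halfK <- : ~~ odd (N - i) by rewrite oddB// oN oi.
    by rewrite Codd// !(mulr0, mul0r).
  by rewrite mom_odd ?mulr0// oddB// oN (negbTE ei).
rewrite -(even_halfK eN); move: (N./2) => M {eN N}.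
rewrite (@sum_even (fun i => 'C(M.*2, i)%:R * al ^+ i * C i (M.*2 - i)%N *
   mom (h - 1 / 2) r (M.*2 - i))); last first.
  move=> i oi; have [iM|iM] := leqP i M.*2; last by rewrite bin_small// !mul0r.
  by rewrite mom_odd ?mulr0// oddB// odd_double oi.
rewrite mom_double (addrC (al ^+ 2)) exprDn !mulr_sumr; apply: eq_bigr => -[i iM] _ /=.
rewrite ltnS in iM.
rewrite -doubleB mom_double Ceven subnKC//.
rewrite -[i.*2]muln2 [X in _ * X * _ * _](_ : _ = (al ^+ 2) ^+ i); last first.
  by rewrite -exprM mulnC.
rewrite muln2 -[_ *+ 'C(M, i)]mulr_natr.
have := bin_double_half iM => E.
have p0 : poch (h - 1 / 2) (M - i) != 0 by apply: poch_neq0; lra.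
have q0 : poch h M != 0 by apply: poch_neq0; lra.
apply: (@eq_trans _ _ (('C(M.*2, i.*2)%:R * poch (1 / 2) i * poch (1 / 2) (M - i))
   * K / poch h M * (al ^+ 2) ^+ i * r ^+ (M - i))); last by rewrite E; field.
by field; rewrite p0 q0.
Qed.

(** Adding one duration: the mixed moments
    [(a)_i (b)_(N-i) / (a + b)_N] are those of a Beta(a, b) variable and of its
    complement to [1]. *)
Lemma mom_dirichlet a b r (N : nat) : 0 < a -> 0 < b ->
  \sum_(i < N.+1) 'C(N, i)%:R * mom ((a + 1) / 2) r i * mom ((b + 1) / 2) r (N - i)
    * (poch a i * poch b (N - i) / poch (a + b) N)
  = mom ((a + b + 1) / 2) r N.
Proof.
move=> a0 b0.
have [oN|eN] := boolP (odd N).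
  rewrite mom_odd// big1// => -[i iN _] /=.
  have [oi|ei] := boolP (odd i); first by rewrite (mom_odd _ _ oi) !(mulr0, mul0r).
  by rewrite (mom_odd ((b + 1) / 2)) ?(mulr0, mul0r)// oddB// oN (negbTE ei).
rewrite -(even_halfK eN); move: (N./2) => M {eN N}.
rewrite (@sum_even (fun i => 'C(M.*2, i)%:R * mom ((a + 1) / 2) r i *
    mom ((b + 1) / 2) r (M.*2 - i)
    * (poch a i * poch b (M.*2 - i) / poch (a + b) M.*2))); last first.
  by move=> i oi; rewrite (mom_odd _ _ oi) !(mulr0, mul0r).
have pa k : poch ((a + 1) / 2) k != 0 by apply: poch_neq0; lra.
have pb k : poch ((b + 1) / 2) k != 0 by apply: poch_neq0; lra.
have pab k : poch ((a + b + 1) / 2) k != 0 by apply: poch_neq0; lra.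
have pab' k : poch ((a + b) / 2) k != 0 by apply: poch_neq0; lra.
have four k : (4 : R) ^+ k != 0 by rewrite expf_neq0// pnatr_eq0.
transitivity (\sum_(i < M.+1) (1 / poch ((a + b) / 2) M
    * (poch (1 / 2) M / poch ((a + b + 1) / 2) M * r ^+ M)) *
    ('C(M, i)%:R * poch (a / 2) i * poch (b / 2) (M - i))).
  apply: eq_bigr => -[i iM] _ /=.
  rewrite -doubleB !mom_double !poch_double.
  have E := @bin_double_half M i iM.
  rewrite (_ : 4 ^+ M = 4 ^+ i * 4 ^+ (M - i)); last by rewrite -exprD subnKC.
  rewrite (_ : r ^+ M = r ^+ i * r ^+ (M - i)); last by rewrite -exprD subnKC.
  transitivity (('C(M.*2, i.*2)%:R * poch (1 / 2) i * poch (1 / 2) (M - i)) *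
    (r ^+ i * r ^+ (M - i) * poch (a / 2) i * poch (b / 2) (M - i) /
     (poch ((a + b) / 2) M * poch ((a + b + 1) / 2) M))).
    by field; rewrite !four !pa !pb !pab !pab'.
  by rewrite E; field; rewrite !pab !pab'.
rewrite -mulr_sumr poch_vandermonde mom_double -mulrDl; field.
by rewrite pab pab'.
Qed.

End poch.

(** * Integrals over an interval and the fundamental theorem of calculus *)

(** [f] is integrable on the line, with integral [v]. *)
Definition has_int {R : realType} (f : R -> R) (v : R) : Prop :=
  (@lebesgue_measure R).-integrable setT (EFin \o f) /\
  (\int[@lebesgue_measure R]_x (f x)%:E = v%:E)%E.

Section onedim.
Context {R : realType}.
Notation mu := (@lebesgue_measure R).
Implicit Types (f F : R -> R) (a b x q : R).

Lemma has_int_lin f g u v k :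
  has_int f u -> has_int g v -> has_int (fun x => k * f x + g x) (k * u + v).
Proof.
move=> [fi fE] [gi gE].
have kfi : mu.-integrable setT (EFin \o (fun x => k * f x)).
  by have := integrableZl measurableT k fi; apply: eq_integrable.
split.
  by have := integrableD measurableT kfi gi; apply: eq_integrable.
under eq_integral do rewrite EFinD.
rewrite integralD//= gE.
under eq_integral do rewrite EFinM.
by rewrite integralZl//= fE -EFinM -EFinD.
Qed.

Lemma has_int0 : has_int (fun _ : R => 0) 0.
Proof.
by split; [exact: integrable0 | rewrite integral0].
Qed.

Lemma continuous_itv_integrable f a b : continuous f ->
  mu.-integrable `[a, b] (EFin \o f).
Proof.
move=> cf; apply: continuous_compact_integrable; first exact: segment_compact.
exact: continuous_subspaceT.
Qed.

Lemma has_int_itvcc f a b : continuous f ->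
  has_int (fun x => if a <= x <= b then f x else 0) (\int[mu]_(x in `[a, b]) f x).
Proof.
move=> cf; have fi := continuous_itv_integrable a b cf.
have E : (fun x => if a <= x <= b then f x else 0) = f \_ `[a, b].
  by apply/funext => x; rewrite patchE mem_setE in_itv.
rewrite E; split; first by rewrite -restrict_EFin; apply/integrable_restrict => //=; rewrite setTI.
rewrite /Rintegral fineK; last exact: integrable_fin_num.
rewrite [RHS]integral_mkcond; apply: eq_integral => x _.
by rewrite !patchE; case: ifP.
Qed.

Lemma has_int_itvoo f a b : continuous f ->
  has_int (fun x => if a < x < b then f x else 0) (\int[mu]_(x in `[a, b]) f x).
Proof.
move=> cf; have fi := continuous_itv_integrable a b cf.
(* The end points are negligible, but the integrals must be moved one by one. *)
have fi2 : mu.-integrable `[a, b[ (EFin \o f).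
  by apply: integrableS fi => //; exact: subset_itv_co_cc.
have fi' : mu.-integrable `]a, b[ (EFin \o f).
  by apply: integrableS fi => //; exact: subset_itv_oo_cc.
have E : (fun x => if a < x < b then f x else 0) = f \_ `]a, b[.
  by apply/funext => x; rewrite patchE mem_setE in_itv.
rewrite E; split; first by rewrite -restrict_EFin; apply/integrable_restrict => //=; rewrite setTI.
rewrite /Rintegral fineK; last exact: integrable_fin_num.
rewrite -integral_itv_bndo_bndc; last exact: (measurable_int mu fi2).
rewrite -integral_itv_obnd_cbnd; last exact: (measurable_int mu fi').
rewrite [RHS]integral_mkcond; apply: eq_integral => x _.
by rewrite !patchE; case: ifP.
Qed.

Lemma Rintegral_derive f F a b : a < b -> continuous f -> continuous F ->
  (forall x, a < x < b -> is_derive x 1 F (f x)) ->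
  \int[mu]_(x in `[a, b]) f x = F b - F a.
Proof.
move=> ab cf cF dF.
rewrite /Rintegral (@continuous_FTC2 _ f F)//.
- exact: continuous_subspaceT.
- split.
  + by move=> x; rewrite in_itv/= => /dF[].
  + by apply: cvg_at_right_filter; exact: cF.
  + by apply: cvg_at_left_filter; exact: cF.
- by move=> x; rewrite in_itv/= => /dF[? <-]; rewrite derive1E.
Qed.

(** The absolute value matters: [x `^ q] is [1] for [x < 0], so that
    [powR] itself is not continuous at [0]. *)
Lemma continuous_abs_powR q : 0 <= q -> continuous (fun x : R => `|x| `^ q).
Proof.
rewrite le_eqVlt => /predU1P[<-|q0].
  by under eq_fun do rewrite powRr0; move=> x; exact: cvg_cst.
move=> x; have [->|x0] := eqVneq x 0.
  rewrite /continuous_at normr0 powR0 ?gt_eqF//.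
  apply/cvgrPdist_lt => e e0; near=> y.
  rewrite sub0r normrN ger0_norm ?powR_ge0//.
  rewrite (_ : e = (e `^ q^-1) `^ q); last first.
    by rewrite -powRrM mulVf ?gt_eqF// powRr1 ?ltW.
  rewrite gt0_ltr_powR ?nnegrE ?powR_ge0//.
  near: y; apply/nbhs_ballP; exists (e `^ q^-1); first exact: powR_gt0.
  by move=> y; rewrite /ball/= sub0r normrN.
apply: (@continuous_comp _ _ _ (fun x : R => `|x|) (fun y => y `^ q)).
  exact: norm_continuous.
apply: differentiable_continuous; apply/derivable1_diffP.
by apply: derivable_powR; rewrite in_itv/= andbT normr_gt0.
Unshelve. all: by end_near. Qed.

(** The product rule in applicative form, for a factor [f] and a factor [F]. *)
Lemma is_derive_mul f F x df dF : is_derive x 1 f df -> is_derive x 1 F dF ->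
  is_derive x 1 (fun y => f y * F y) (df * F x + f x * dF).
Proof.
move=> Hf HF; apply: (is_derive_eq (is_deriveM Hf HF)).
by rewrite /GRing.scale/= addrC mulrC.
Qed.

Lemma is_derive_exp n f x df : is_derive x 1 f df ->
  is_derive x 1 (fun y => f y ^+ n) (n%:R * f x ^+ n.-1 * df).
Proof.
move=> Hf; have := is_deriveX n Hf; congr (is_derive _ _ _ _).
by rewrite exprfctE.
Qed.

Lemma is_derive_abs_powR q x : x != 0 ->
  is_derive x 1 (fun y : R => `|y| `^ q) (q * `|x| `^ q / x).
Proof.
move=> x0.
have sqr_powR y : (y ^+ 2) `^ (q / 2) = `|y| `^ q.
  rewrite -real_normK ?num_real// -powR_mulrn// -powRrM.
  by congr (_ `^ _); field.
have -> : (fun y : R => `|y| `^ q) = (fun z => z `^ (q / 2)) \o (fun y => y ^+ 2).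
  by apply/funext => y/=; rewrite sqr_powR.
have x20 : 0 < x ^+ 2 by rewrite exprn_even_gt0.
have d2 : is_derive x 1 (fun y : R => y ^+ 2) (2 * x).
  by have := is_derive_exp 2 (is_derive_id x 1); rewrite expr1 mulr1.
apply: (is_derive_eq (@is_derive1_comp _ _ (fun y : R => y ^+ 2) x _ _
  (is_derive1_powR (q / 2) x20) d2)).
rewrite powRB; last by rewrite (gt_eqF x20) implybT.
by rewrite powRr1 ?ltW// sqr_powR; field.
Qed.

End onedim.

(** * Trigonometric integrals *)

Section trig.
Context {R : realType}.
Notation mu := (@lebesgue_measure R).
Implicit Types (a b x q T p : R).

(** The integrand [cos^i sin^l] against the weight [|sin|^q]. *)
Definition trigf q (i l : nat) x : R := `|sin x| `^ q * cos x ^+ i * sin x ^+ l.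

Lemma continuous_exp (f : R -> R) n : continuous f -> continuous (fun x => f x ^+ n).
Proof.
move=> cf x; apply: (@continuous_comp _ _ _ f (fun y => y ^+ n)); first exact: cf.
exact: exprn_continuous.
Qed.

Lemma continuous_trigf q i l : 0 <= q -> continuous (trigf q i l).
Proof.
move=> q0 x; rewrite /trigf; apply: cvgM; first apply: cvgM.
- apply: (@continuous_comp _ _ _ sin (fun y => `|y| `^ q)).
    exact: continuous_sin.
  exact: continuous_abs_powR.
- by apply: continuous_exp; exact: continuous_cos.
- by apply: continuous_exp; exact: continuous_sin.
Qed.

Lemma is_derive_abs_sin q x : sin x != 0 ->
  is_derive x 1 (fun y => `|sin y| `^ q) (q * `|sin x| `^ q / sin x * cos x).
Proof.
move=> s0; exact: (@is_derive1_comp _ (fun y => `|y| `^ q) sin _ _ _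
  (is_derive_abs_powR q s0) (is_derive_sin x)).
Qed.

Lemma is_derive_trigf q i l x : sin x != 0 ->
  is_derive x 1 (trigf q i l.+1)
   ((q + l.+1%:R) * trigf q i.+1 l x - i%:R * trigf q i.-1 l.+2 x).
Proof.
move=> s0; rewrite /trigf.
have D := is_derive_mul (is_derive_mul (is_derive_abs_sin q s0)
  (is_derive_exp i (is_derive_cos x))) (is_derive_exp l.+1 (is_derive_sin x)).
apply: (is_derive_eq D) => /=; case: i D => [|i] _ /=.
  by rewrite !expr0 expr1 exprS; field.
by rewrite !exprS; field.
Qed.

(** The integral of [trigf q i l] over [[a, b]]. *)
Definition trig_int q a b i l : R := \int[mu]_(x in `[a, b]) trigf q i l x.

(** The relations that determine all the integrals [J i l] of
    [trigf q i l] up to a common factor: integration by parts, the identity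
    [cos^2 + sin^2 = 1], and the vanishing of the first moment of the cosine. They
    are linear in [J], hence hold on a union of intervals as soon as they hold on
    each. *)
Definition trig_rec q (J : nat -> nat -> R) :=
  (forall i l, (q + l.+1%:R) * J i.+2 l = i.+1%:R * J i l.+2) /\
  (forall i l, J i l = J i.+2 l + J i l.+2) /\ (forall l, J 1 l = 0).

Lemma trig_int_rec q a b : 0 <= q -> a < b -> sin a = 0 -> sin b = 0 ->
  (forall x, a < x < b -> sin x != 0) -> trig_rec q (trig_int q a b).
Proof.
move=> q0 ab sa sb sx.
have ti i l : mu.-integrable `[a, b] (EFin \o trigf q i l).
  by apply: continuous_itv_integrable; exact: continuous_trigf.
have tiZ k i l : mu.-integrable `[a, b] (EFin \o (fun x => k * trigf q i l x)).
  apply: continuous_itv_integrable => x; apply: cvgM; first exact: cvg_cst.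
  exact: continuous_trigf.
(* The derivative of [|sin|^q cos^i sin^(l+1)] integrates to zero. *)
have K i l : (q + l.+1%:R) * trig_int q a b i.+1 l
    - i%:R * trig_int q a b i.-1 l.+2 = 0.
  rewrite /trig_int -!RintegralZl// -RintegralB//.
  set f := (f in \int[mu]_(x in _) f x).
  have -> : \int[mu]_(x in `[a, b]) f x = trigf q i l.+1 b - trigf q i l.+1 a.
    apply: Rintegral_derive => //.
    - move=> x; apply: cvgB; (apply: cvgM; first exact: cvg_cst);
        exact: continuous_trigf.
    - exact: continuous_trigf.
    - by move=> x /sx; exact: is_derive_trigf.
  by rewrite /trigf sa sb !exprS !mul0r !mulr0 subr0.
split; [|split] => [i l|i l|l].
- by have /eqP := K i.+1 l; rewrite subr_eq0 => /eqP.
- rewrite /trig_int -RintegralD//; apply: eq_Rintegral => x _.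
  by rewrite /trigf -(addn2 i) -(addn2 l) !exprD cos2sin2; ring.
- have /eqP := K 0%N l; rewrite mul0r subr0 mulf_eq0 => /orP[|/eqP//].
  by rewrite gt_eqF// ltr_wpDl.
Qed.

Lemma trig_recD q J J' : trig_rec q J -> trig_rec q J' ->
  trig_rec q (fun i l => J i l + J' i l).
Proof.
move=> [A1 [A2 A3]] [B1 [B2 B3]]; split; [|split] => [i l|i l|l].
- by rewrite !mulrDr A1 B1.
- by rewrite A2 B2; ring.
- by rewrite A3 B3 addr0.
Qed.

Lemma trig_rec_step q J i l : 0 <= q -> trig_rec q J ->
  J i.+2 l = i.+1%:R / (i%:R + l%:R + q + 2) * J i l /\
  J i l.+2 = (q + l.+1%:R) / (i%:R + l%:R + q + 2) * J i l.
Proof.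
move=> q0 [A1 [A2 _]].
have d0 : i%:R + l%:R + q + 2 != 0 :> R.
  by rewrite gt_eqF// ltr_wpDl// addr_ge0// addr_ge0.
have E1 := A1 i l; have E2 := A2 i l.
rewrite -(natr1 i) -(natr1 l) in E1 *.
set d := i%:R + l%:R + q + 2 in d0 *.
have cancel n z : d * (n / d * z) = n * z by field.
by split; apply: (mulfI d0); rewrite cancel E2 /d; lra.
Qed.

Lemma trig_rec_odd q J i l : 0 <= q -> trig_rec q J -> odd i -> J i l = 0.
Proof.
move=> q0 H oi; rewrite -(odd_double_half i) oi add1n.
elim: i./2 => [|k IH]; first by case: H => _ [_ ->].
by rewrite doubleS (trig_rec_step _ _ q0 H).1 IH mulr0.
Qed.

Lemma trig_rec_even q J i l : 0 <= q -> trig_rec q J ->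
  J i.*2 l.*2 = J 0 0 *
    (poch (1 / 2) i * poch ((q + 1) / 2) l / poch ((q + 2) / 2) (i + l)).
Proof.
move=> q0 H.
have pn k : poch ((q + 2) / 2) k != 0 by apply: poch_neq0; lra.
have d0 k : q + 2 + k%:R != 0 :> R.
  by rewrite gt_eqF// ltr_wpDr// ltr_wpDl.
elim: i => [|i IH].
  elim: l => [|l IH]; first by rewrite !poch0 !mulr1 divr1 mulr1.
  rewrite doubleS (trig_rec_step _ _ q0 H).2 IH double0 !add0n !pochS -(natr1 l.*2) -muln2 natrM.
  field; rewrite pn/=; have := d0 (l * 2)%N; rewrite natrM.
  by move=> ->.
rewrite doubleS (trig_rec_step _ _ q0 H).1 IH addSn !pochS -(natr1 i.*2) -!muln2 !natrM natrD.
field; rewrite pn/=; have := d0 ((i + l) * 2)%N; rewrite natrM natrD.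
by move=> ->.
Qed.

End trig.

(** * Beta integrals *)

Section beta.
Context {R : realType}.
Notation mu := (@lebesgue_measure R).
Implicit Types (x q T p : R).

(** The integrand [x^(p + i) (T - x)^(q + l)] of the Beta integral on [[0, T]];
    the absolute values make it continuous on the whole line for [p, q >= 0]. *)
Definition betaf p q T (i l : nat) x : R :=
  `|x| `^ p * `|T - x| `^ q * x ^+ i * (T - x) ^+ l.

(** The integral of [betaf p q T i l] over [[0, T]]. *)
Definition beta_int p q T i l : R := \int[mu]_(x in `[0, T]) betaf p q T i l x.

Lemma continuous_betaf p q T i l : 0 <= p -> 0 <= q -> continuous (betaf p q T i l).
Proof.
move=> p0 q0 x; rewrite /betaf.
have cT : continuous (fun y => T - y).
  by move=> y; apply: cvgB; [exact: cvg_cst|exact: cvg_id].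
apply: cvgM; first apply: cvgM; first apply: cvgM.
- exact: continuous_abs_powR.
- apply: (@continuous_comp _ _ _ (fun y => T - y) (fun y => `|y| `^ q)).
    exact: cT.
  exact: continuous_abs_powR.
- exact: exprn_continuous.
- exact: (continuous_exp (n := l) cT).
Qed.

Lemma is_derive_betaf p q T i l x : x != 0 -> T - x != 0 ->
  is_derive x 1 (betaf p q T i.+1 l.+1)
   ((p + i.+1%:R) * betaf p q T i l.+1 x - (q + l.+1%:R) * betaf p q T i.+1 l x).
Proof.
move=> x0 Tx0; rewrite /betaf.
have DT : is_derive x 1 (fun y => T - y) (- 1).
  by apply: (is_derive_eq (is_deriveB (is_derive_cst T x 1) (is_derive_id x 1)));
    rewrite sub0r.
have Dq := @is_derive1_comp _ (fun y => `|y| `^ q) (fun y => T - y) x _ _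
  (is_derive_abs_powR q Tx0) DT.
have D := is_derive_mul (is_derive_mul (is_derive_mul (is_derive_abs_powR p x0)
  Dq) (is_derive_exp i.+1 (is_derive_id x 1))) (is_derive_exp l.+1 DT).
apply: (is_derive_eq D) => /=.
by rewrite !exprS; field; rewrite x0 Tx0.
Qed.

Lemma beta_int_rec p q T i l : 0 <= p -> 0 <= q -> 0 < T ->
  (p + i.+1%:R) * beta_int p q T i l.+1 = (q + l.+1%:R) * beta_int p q T i.+1 l /\
  T * beta_int p q T i l = beta_int p q T i.+1 l + beta_int p q T i l.+1.
Proof.
move=> p0 q0 T0.
have ti i' l' : mu.-integrable `[0, T] (EFin \o betaf p q T i' l').
  by apply: continuous_itv_integrable; exact: continuous_betaf.
have tiZ k i' l' : mu.-integrable `[0, T] (EFin \o (fun x => k * betaf p q T i' l' x)).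
  apply: continuous_itv_integrable => x; apply: cvgM; first exact: cvg_cst.
  exact: continuous_betaf.
split.
  apply/eqP; rewrite -subr_eq0; apply/eqP.
  rewrite /beta_int -!RintegralZl// -RintegralB//.
  set f := (f in \int[mu]_(x in _) f x).
  have -> : \int[mu]_(x in `[0, T]) f x = betaf p q T i.+1 l.+1 T - betaf p q T i.+1 l.+1 0.
    apply: Rintegral_derive => //.
    - move=> x; apply: cvgB; (apply: cvgM; first exact: cvg_cst);
        exact: continuous_betaf.
    - exact: continuous_betaf.
    - move=> x /andP[x0 xT]; apply: is_derive_betaf; first by rewrite gt_eqF.
      by rewrite subr_eq0 gt_eqF.
  by rewrite /betaf subrr !exprS !mul0r !mulr0 !mul0r subr0.
rewrite /beta_int -RintegralD// -RintegralZl//; apply: eq_Rintegral => x _.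
by rewrite /betaf !exprS; ring.
Qed.

Lemma beta_int_step p q T i l : 0 <= p -> 0 <= q -> 0 < T ->
  beta_int p q T i.+1 l =
    T * (p + i.+1%:R) / (p + q + 2 + (i + l)%:R) * beta_int p q T i l /\
  beta_int p q T i l.+1 =
    T * (q + l.+1%:R) / (p + q + 2 + (i + l)%:R) * beta_int p q T i l.
Proof.
move=> p0 q0 T0; have [E1 E2] := beta_int_rec i l p0 q0 T0.
have d0 : p + q + 2 + (i + l)%:R != 0.
  by rewrite gt_eqF// ltr_wpDr// ltr_wpDl// addr_ge0.
rewrite natrD in d0 *.
rewrite -(natr1 i) -(natr1 l) in E1 *.
set d := p + q + 2 + (i%:R + l%:R) in d0 *.
have cancel n z : d * (T * n / d * z) = n * (T * z) by field.
by split; apply: (mulfI d0); rewrite cancel E2 /d; lra.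
Qed.

Lemma beta_intE p q T i l : 0 <= p -> 0 <= q -> 0 < T ->
  beta_int p q T i l = beta_int p q T 0 0 * T ^+ (i + l) *
    (poch (p + 1) i * poch (q + 1) l / poch (p + q + 2) (i + l)).
Proof.
move=> p0 q0 T0.
have h0 : 0 < p + q + 2 by rewrite ltr_wpDl// addr_ge0.
have pn k : poch (p + q + 2) k != 0 by apply: poch_neq0.
have d0 k : p + q + 2 + k%:R != 0 by rewrite gt_eqF// ltr_wpDr.
elim: i => [|i IH].
  elim: l => [|l IH]; first by rewrite !poch0 expr0 !mulr1 divr1 mulr1.
  rewrite (beta_int_step 0 l p0 q0 T0).2 IH !add0n !pochS exprS -(natr1 l).
  by field; rewrite pn d0.
rewrite (beta_int_step i l p0 q0 T0).1 IH addSn !pochS exprS -(natr1 i).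
by field; rewrite pn -natrD d0.
Qed.

Lemma beta_int_scale p q T : 0 <= p -> 0 <= q -> 0 < T ->
  beta_int p q T 0 0 = T `^ (p + q + 1) * beta_int p q 1 0 0.
Proof.
move=> p0 q0 T0.
have D x : is_derive x 1 (fun y => T * y) T.
  have := is_derive_mul (is_derive_cst T x 1) (is_derive_id x 1).
  by rewrite mul0r add0r mulr1.
have D1 : (fun y => T * y)^`()%classic = cst T.
  by apply/funext => x; rewrite derive1E; case: (D x).
have cT : continuous (fun y => T * y).
  by move=> x; apply: cvgM; [exact: cvg_cst|exact: cvg_id].
rewrite /beta_int /Rintegral.
have := @integration_by_substitution_increasing R (fun y => T * y)
  (betaf p q T 0 0) 0 1 ler01.
rewrite D1 mulr0 mulr1 => ->.
- rewrite -[RHS]RintegralZl//; last first.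
    by apply: continuous_itv_integrable; exact: continuous_betaf.
  congr fine; apply: eq_integral => x _; congr EFin.
  rewrite /= /betaf !fctE /= !expr0 !mulr1 (_ : T - T * x = T * (1 - x)); last by ring.
  rewrite !normrM (ger0_norm (ltW T0)) !powRM// ?(ltW T0)//.
  by rewrite !powRD ?(gt_eqF T0) ?implybT// powRr1 ?ltW//; ring.
- by move=> x y _ _ xy; rewrite ltr_pM2l.
- by move=> x _; exact: cvg_cst.
- exact: is_cvg_cst.
- exact: is_cvg_cst.
- split.
  + by move=> x _; case: (D x).
  + by apply: cvg_at_right_filter; exact: cT.
  + by apply: cvg_at_left_filter; exact: cT.
- by apply: continuous_subspaceT; exact: continuous_betaf.
Qed.

End beta.

(** * Iterated integrals and the moments of one direction *)

(** [f] has the iterated integral [v], every successive integral being taken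
    of an integrable function. Unlike [iint], this makes sense for functions of
    any sign. *)
Fixpoint has_iint {R : realType} {n : nat} : (n.-tuple R -> R) -> R -> Prop :=
  match n with
  | 0 => fun f v => f [tuple] = v
  | n'.+1 => fun f v => exists2 g : R -> R,
      forall x, has_iint (fun s : n'.-tuple R => f [tuple of x :: s]) (g x) &
      has_int g v
  end.

Section has_iint.
Context {R : realType}.
Notation mu := (@lebesgue_measure R).

Lemma has_iint_iint n (f : n.-tuple R -> R) v :
  has_iint f v -> iint (fun s => (f s)%:E) = v%:E.
Proof.
elim: n f v => [|n IH] f v /=; first by move=> ->.
by move=> [g fg [_ <-]]; apply: eq_integral => x _; exact: IH.
Qed.

Lemma has_iint_lin n (f g : n.-tuple R -> R) k u v : has_iint f u -> has_iint g v ->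
  has_iint (fun s => k * f s + g s) (k * u + v).
Proof.
elim: n f g u v => [|n IH] f g u v /=; first by move=> -> ->.
move=> [f' ff' If] [g' gg' Ig]; exists (fun x => k * f' x + g' x).
  by move=> x; exact: IH.
exact: has_int_lin.
Qed.

Lemma has_iint0 n : has_iint (fun _ : n.-tuple R => 0) 0.
Proof. by elim: n => [//|n IH] /=; exists (fun=> 0) => //; exact: has_int0. Qed.

Lemma has_iintZ n (f : n.-tuple R -> R) k u : has_iint f u ->
  has_iint (fun s => k * f s) (k * u).
Proof.
move=> H; have := has_iint_lin k H (has_iint0 n); rewrite addr0.
by under eq_fun do rewrite addr0.
Qed.

Lemma has_iint_sum n m (F : nat -> n.-tuple R -> R) (u : nat -> R) :
  (forall i, (i < m)%N -> has_iint (F i) (u i)) ->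
  has_iint (fun s => \sum_(i < m) F i s) (\sum_(i < m) u i).
Proof.
elim: m => [|m IH] H.
  by rewrite big_ord0; under eq_fun do rewrite big_ord0; exact: has_iint0.
rewrite big_ord_recr/= addrC -[u m]mul1r.
under eq_fun do rewrite big_ord_recr/= addrC -[F m _]mul1r.
by apply: has_iint_lin; [exact: H|apply: IH => i im; exact/H/ltnW].
Qed.

Lemma has_int_sum m (F : nat -> R -> R) (u : nat -> R) :
  (forall i, (i < m)%N -> has_int (F i) (u i)) ->
  has_int (fun s => \sum_(i < m) F i s) (\sum_(i < m) u i).
Proof.
elim: m => [|m IH] H.
  by rewrite big_ord0; under eq_fun do rewrite big_ord0; exact: has_int0.
rewrite big_ord_recr/= addrC -[u m]mul1r.
under eq_fun do rewrite big_ord_recr/= addrC -[F m _]mul1r.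
by apply: has_int_lin; [exact: H|apply: IH => i im; exact/H/ltnW].
Qed.

Lemma has_intZ (f : R -> R) k u : has_int f u -> has_int (fun s => k * f s) (k * u).
Proof.
move=> H; have := has_int_lin k H has_int0; rewrite addr0.
by under eq_fun do rewrite addr0.
Qed.

End has_iint.

Section angles.
Context {R : realType}.
Notation mu := (@lebesgue_measure R).
Implicit Types (p q T a r : R) (s : seq R) (al : nat -> R).

(** The angle density up to its constant: [|sin|^p] for the first angle,
    [|sin|^(p - 1)] for the second, and so on. The last angle ranges over
    [[0, 2 pi]], the others over [[0, pi]]. *)
Fixpoint angle_weight p s : R :=
  if s is x :: s' then
    if s' is [::] then (if 0 <= x <= 2 * pi then `|sin x| `^ p else 0)
    else (if 0 <= x <= pi then `|sin x| `^ p * angle_weight (p - 1) s' else 0)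
  else 1.

(** The scalar product of [(al 0, al 1, ...)] with the direction given by the
    angles [s], the coordinate that carries only sines being left out. *)
Fixpoint direction al s : R :=
  if s is x :: s' then al 0%N * cos x + sin x * direction (fun i => al i.+1) s'
  else 0.

Lemma trig_rec_pi q : 0 <= q -> trig_rec q (trig_int q 0 pi).
Proof.
move=> q0; apply: trig_int_rec => //; first exact: pi_gt0.
- exact: sin0.
- exact: sinpi.
- by move=> x x0; rewrite gt_eqF// sin_gt0_pi.
Qed.

Lemma trig_rec_2pi q : 0 <= q -> trig_rec q (trig_int q 0 (2 * pi)).
Proof.
move=> q0; have pi0 := pi_gt0 R.
have -> : trig_int q 0 (2 * pi) = fun i l => trig_int q 0 pi i l + trig_int q pi (2 * pi) i l.
  apply/funext => i; apply/funext => l; rewrite /trig_int.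
  have ti : mu.-integrable `[0, 2 * pi] (EFin \o trigf q i l).
    by apply: continuous_itv_integrable; exact: continuous_trigf.
  rewrite -[X in _ + X]Rintegral_itv_obnd_cbnd.
    rewrite -(Rintegral_itvB ti) ?bnd_simp; [|lra|lra].
    by rewrite addrC subrK.
  apply: integrableS ti => // x/=; rewrite !in_itv/=; lra.
(* The weight [|sin|^q] is smooth except at the zeros of the sine, so the
   interval is cut at [pi]. *)
apply: trig_recD; first exact: trig_rec_pi.
apply: trig_int_rec => //; [lra|exact: sinpi| |].
  by rewrite mulr_natl sin2pi.
move=> x xpi; rewrite -[x](subrK pi) sinDpi oppr_eq0 gt_eqF// sin_gt0_pi//; lra.
Qed.

Lemma angle_weight_moments k p : 0 <= p - k%:R -> exists Z, forall al N,
  has_iint (fun s : k.+1.-tuple R => angle_weight p s * direction al s ^+ N)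
    (Z * mom ((p + 2) / 2) (\sum_(i < k.+1) al i ^+ 2) N).
Proof.
elim: k p => [|k IH] p pk.
  rewrite subr0 in pk; have J := trig_rec_2pi pk.
  exists (trig_int p 0 (2 * pi) 0 0) => al N /=.
  exists (fun x => al 0%N ^+ N * (if 0 <= x <= 2 * pi then trigf p N 0 x else 0)).
    move=> x; case: ifP => _; last by rewrite mul0r mulr0.
    by rewrite mulr0 addr0 /trigf expr0 mulr1 exprMn; ring.
  rewrite big_ord_recl big_ord0 addr0.
  have [oN|eN] := boolP (odd N).
    rewrite [X in has_int _ X](_ : _ = al 0%N ^+ N * trig_int p 0 (2 * pi) N 0); last first.
      by rewrite mom_odd// (trig_rec_odd 0 pk J oN) !mulr0.
    by apply: has_intZ; apply: has_int_itvcc; exact: continuous_trigf.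
  rewrite -(even_halfK eN) mom_double.
  rewrite [X in has_int _ X](_ : _ = al 0%N ^+ N./2.*2 * trig_int p 0 (2 * pi) N./2.*2 0.*2).
    by apply: has_intZ; apply: has_int_itvcc; exact: continuous_trigf.
  rewrite (trig_rec_even _ 0 pk J) addn0 poch0 mulr1 -exprM mul2n; ring.
have pk' : 0 <= p - 1 - k%:R by rewrite -natr1 in pk; lra.
have p0 : 0 <= p by have := ler0n R k; lra.
have [Z HZ] := IH _ pk'; have J := trig_rec_pi p0.
exists (Z * trig_int p 0 pi 0 0) => al N.
set al' := fun i => al i.+1.
set r := \sum_(i < k.+1) al' i ^+ 2.
pose c i := 'C(N, i)%:R * al 0%N ^+ i * Z * mom ((p - 1 + 2) / 2) r (N - i).
exists (fun x => \sum_(i < N.+1) c i *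
    (if 0 <= x <= pi then trigf p i (N - i) x else 0)).
  move=> x; have [xI|xI] := boolP (0 <= x <= pi); last first.
    rewrite big1 ?mulr0//; last by move=> i _; rewrite mulr0.
    rewrite [X in has_iint X](_ : _ = fun=> 0); first exact: has_iint0.
    by apply/funext => -[[|y s]//= _]; rewrite (negbTE xI) mul0r.
  rewrite [X in has_iint X](_ : _ = fun v : k.+1.-tuple R => \sum_(i < N.+1)
    ('C(N, i)%:R * al 0%N ^+ i * trigf p i (N - i) x) *
    (angle_weight (p - 1) v * direction al' v ^+ (N - i))); last first.
    apply/funext => v; transitivity
      (`|sin x| `^ p * angle_weight (p - 1) v * (al 0%N * cos x + sin x * direction al' v) ^+ N).
      by case: v => -[|y s]//= _; rewrite xI.
    rewrite (addrC (al 0%N * _)) exprDn mulr_sumr; apply: eq_bigr => i _.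
    by rewrite -[X in _ * X = _]mulr_natr !exprMn /trigf; ring.
  rewrite [X in has_iint _ X](_ : _ = \sum_(i < N.+1)
    ('C(N, i)%:R * al 0%N ^+ i * trigf p i (N - i) x) *
    (Z * mom ((p - 1 + 2) / 2) r (N - i))); last first.
    by apply: eq_bigr => i _; rewrite /c; ring.
  apply: (has_iint_sum (F := fun i (v : k.+1.-tuple R) =>
    ('C(N, i)%:R * al 0%N ^+ i * trigf p i (N - i) x) *
    (angle_weight (p - 1) v * direction al' v ^+ (N - i)))
   (u := fun i => ('C(N, i)%:R * al 0%N ^+ i * trigf p i (N - i) x) *
    (Z * mom ((p - 1 + 2) / 2) r (N - i)))) => i _.
  by apply: has_iintZ; exact: HZ.
rewrite [X in has_int _ X](_ : _ = \sum_(i < N.+1) c i * trig_int p 0 pi i (N - i)); last first.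
  rewrite big_ord_recl/= -/al' -/r.
  rewrite -mulrA -(@mom_trig _ ((p + 2) / 2) (al 0%N) r _ (trig_int p 0 pi) N).
  - rewrite mulr_sumr; apply: eq_bigr => i _; rewrite /c.
    have -> : (p - 1 + 2) / 2 = (p + 2) / 2 - 1 / 2 by field.
    ring.
  - lra.
  - move=> i l; rewrite (trig_rec_even _ _ p0 J).
    by have -> : (p + 2) / 2 - 1 / 2 = (p + 1) / 2 by field.
  - by move=> i l oi; exact: (trig_rec_odd _ p0 J oi).
apply: (has_int_sum (F := fun i x => c i *
    (if 0 <= x <= pi then trigf p i (N - i) x else 0))
  (u := fun i => c i * trig_int p 0 pi i (N - i))) => i _.
by apply: has_intZ; apply: has_int_itvcc; exact: continuous_trigf.
Qed.

End angles.

(** * Moments of a sum weighted by Dirichlet durations *)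

Section times.
Context {R : realType}.
Notation mu := (@lebesgue_measure R).
Implicit Types (p q T a r : R) (s : seq R) (m : nat -> R).

(** The duration density up to its constant, for total time [T] and the
    durations [s] of all segments but the last. *)
Fixpoint time_weight a T s : R :=
  if s is x :: s' then
    if 0 < x < T then `|x| `^ (a - 1) * time_weight a (T - x) s' else 0
  else `|T| `^ (a - 1).

(** The durations of all segments, the last one being what [s] leaves of [T]. *)
Fixpoint durations_seq T s : seq R := if s is x :: s' then x :: durations_seq (T - x) s' else [:: T].

(** The [N]-th moment of [\sum_k x_k W_k] for the coefficients [x_k] listed
    in [s], when the [W_k] are independent with common moments [m]. *)
Fixpoint sum_moment m s (N : nat) : R :=
  if s is x :: s' then
    \sum_(i < N.+1) 'C(N, i)%:R * x ^+ i * m i * sum_moment m s' (N - i)%N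
  else (N == 0%N)%:R.

Lemma sum_moment1 m x N : sum_moment m [:: x] N = x ^+ N * m N.
Proof.
rewrite /= (bigD1 ord_max)//= subnn eqxx binn mulr1 mul1r big1 ?addr0// => -[i iN].
rewrite -val_eqE /= => iNE; rewrite subn_eq0 leqNgt.
by rewrite ltn_neqAle iNE -ltnS iN mulr0.
Qed.

Lemma time_weight_moments n a : 1 <= a -> exists Z, forall T r N, 0 < T ->
  has_iint (fun s : n.-tuple R => time_weight a T s *
     sum_moment (mom ((a + 1) / 2) r) (durations_seq T s) N)
   (Z * (`|T| `^ (n.+1%:R * a - 1) * T ^+ N * mom ((n.+1%:R * a + 1) / 2) r N)).
Proof.
move=> a1; elim: n => [|n [Z HZ]].
  exists 1 => T r N T0; rewrite [has_iint _ _]/= -/(sum_moment _ [:: T] N).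
  by rewrite sum_moment1 !mul1r mulrA.
set b := n.+1%:R * a in HZ *.
have b1 : 1 <= b by rewrite /b -[leLHS]mulr1 ler_pM// ler1n.
have p0 : 0 <= a - 1 by lra.
have q0 : 0 <= b - 1 by lra.
have bE : n.+2%:R * a = a + b by rewrite -natr1 mulrDl mul1r addrC.
exists (Z * beta_int (a - 1) (b - 1) 1 0 0) => T r N T0; rewrite bE.
pose M := mom ((a + 1) / 2) r.
pose c i := Z * ('C(N, i)%:R * M i * mom ((b + 1) / 2) r (N - i)).
exists (fun x => \sum_(i < N.+1) c i *
    (if 0 < x < T then betaf (a - 1) (b - 1) T i (N - i) x else 0)).
  move=> x; have [xI|xI] := boolP (0 < x < T); last first.
    rewrite big1 ?mulr0//; last by move=> i _; rewrite mulr0.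
    rewrite [X in has_iint X](_ : _ = fun=> 0); first exact: has_iint0.
    by apply/funext => v /=; rewrite (negbTE xI) mul0r.
  have Tx0 : 0 < T - x by rewrite subr_gt0; case/andP: xI.
  rewrite [X in has_iint X](_ : _ = fun v : n.-tuple R => \sum_(i < N.+1)
    ('C(N, i)%:R * `|x| `^ (a - 1) * x ^+ i * M i) *
    (time_weight a (T - x) v * sum_moment M (durations_seq (T - x) v) (N - i))); last first.
    apply/funext => v /=; rewrite xI mulr_sumr; apply: eq_bigr => i _; rewrite -/M.
    ring.
  rewrite [X in has_iint _ X](_ : _ = \sum_(i < N.+1)
    ('C(N, i)%:R * `|x| `^ (a - 1) * x ^+ i * M i) *
    (Z * (`|T - x| `^ (b - 1) * (T - x) ^+ (N - i) * mom ((b + 1) / 2) r (N - i))));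
    last by apply: eq_bigr => i _; rewrite /c /betaf; ring.
  apply: (has_iint_sum (F := fun i (v : n.-tuple R) =>
    ('C(N, i)%:R * `|x| `^ (a - 1) * x ^+ i * M i) *
    (time_weight a (T - x) v * sum_moment M (durations_seq (T - x) v) (N - i)))
   (u := fun i => ('C(N, i)%:R * `|x| `^ (a - 1) * x ^+ i * M i) *
    (Z * (`|T - x| `^ (b - 1) * (T - x) ^+ (N - i) *
      mom ((b + 1) / 2) r (N - i))))) => i _.
  by apply: has_iintZ; exact: HZ.
rewrite [X in has_int _ X](_ : _ =
  \sum_(i < N.+1) c i * beta_int (a - 1) (b - 1) T i (N - i)); last first.
  rewrite -(mom_dirichlet r N (_ : 0 < a) (_ : 0 < b)) ?(lt_le_trans ltr01)//.
  rewrite !mulr_sumr; apply: eq_bigr => -[i iN] _ /=.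
  rewrite (beta_intE i (N - i) p0 q0 T0) (beta_int_scale p0 q0 T0) subnKC -1?ltnS// (ger0_norm (ltW T0)).
  have -> : a - 1 + (b - 1) + 1 = a + b - 1 by ring.
  have -> : a - 1 + (b - 1) + 2 = a + b by ring.
  rewrite !subrK /c /M; ring.
apply: (has_int_sum (F := fun i x => c i *
    (if 0 < x < T then betaf (a - 1) (b - 1) T i (N - i) x else 0))
  (u := fun i => c i * beta_int (a - 1) (b - 1) T i (N - i))) => i _.
by apply: has_intZ; apply: has_int_itvoo; exact: continuous_betaf.
Qed.

End times.

(** * Iterated integrals of nonnegative functions and random vectors with a density *)

Import HBNNSimple.

(** Induction on nonnegative measurable functions: indicators, nonnegative
    combinations, and increasing limits. *)
Lemma nonneg_measurable_ind (R : realType) (d : measure_display)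
    (T : measurableType d) (C : (T -> R) -> Prop) :
  (forall A, measurable A -> C \1_A) ->
  (forall (k : R) (f g : T -> R), 0 <= k -> measurable_fun setT f -> measurable_fun setT g ->
    (forall x, 0 <= f x) -> (forall x, 0 <= g x) -> C f -> C g ->
    C (fun x => k * f x + g x)) ->
  (forall (F : nat -> T -> R) (f : T -> R), (forall n, measurable_fun setT (F n)) ->
    (forall n x, 0 <= F n x) -> (forall x, nondecreasing_seq (F ^~ x)) ->
    measurable_fun setT f -> (forall x, F n x @[n --> \oo] --> f x) ->
    (forall n, C (F n)) -> C f) ->
  forall f : T -> R, measurable_fun setT f -> (forall x, 0 <= f x) -> C f.
Proof.
move=> Cind Clin Clim f mf f0.
have mEf : measurable_fun setT (EFin \o f) by exact/measurable_EFinP.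
apply: (Clim (fun n => nnsfun_approx measurableT mEf n)) => //.
- by move=> x m n mn; have /lefP := nd_nnsfun_approx measurableT mEf mn; exact.
- move=> x.
  have := @cvg_nnsfun_approx _ _ _ _ measurableT _ mEf (fun t _ => f0 t) x I.
  by move/fine_cvg; apply: cvg_trans.
- move=> n; set g := nnsfun_approx _ _ n.
  have finr : finite_set (range g) by exact: fimfunP.
  have gE x : g x = \sum_(y <- finmap.enum_fset (fset_set (range g))) (y * \1_(g @^-1` [set y]) x).
    by rewrite fimfunE fsbig_finite.
  have s0 y : y \in finmap.enum_fset (fset_set (range g)) -> 0 <= y.
    move=> ys; have [x _ <-] : range g y by apply/set_mem; rewrite -(in_fset_set finr).
    exact: fun_ge0.
  rewrite (_ : (g : T -> R) = fun x => \sum_(y <- finmap.enum_fset (fset_set (range g)))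
    (y * \1_(g @^-1` [set y]) x)); last exact/funext.
  move: s0 {gE}; move: (finmap.enum_fset (fset_set (range g))); elim => [|y s IH] s0.
    rewrite [X in C X](_ : _ = \1_set0); first exact: Cind.
    by apply/funext => x; rewrite big_nil indicE in_set0.
  rewrite [X in C X](_ : _ = fun x => y * \1_(g @^-1` [set y]) x +
    \sum_(z <- s) (z * \1_(g @^-1` [set z]) x)); last first.
    by apply/funext => x; rewrite big_cons.
  have s0' z : z \in s -> 0 <= z by move=> zs; apply: s0; rewrite inE zs orbT.
  have mg z : measurable (g @^-1` [set z]) by rewrite -[X in measurable X]setTI; exact: measurable_funP.
  apply: Clin.
  + by apply: s0; rewrite inE eqxx.
  + exact: measurable_indic.
  + by apply: measurable_sum => z; apply: measurable_funM.
  + by move=> x; rewrite indicE.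
  + move=> x; rewrite big_seq; apply: sumr_ge0 => z zs.
    by apply: mulr_ge0; [exact: s0'|rewrite indicE].
  + exact: Cind.
  + exact: IH.
Qed.

Section iint.
Context {R : realType}.
Notation mu := (@lebesgue_measure R).
Local Open Scope ereal_scope.

Lemma iint_ge0 n (f : n.-tuple R -> \bar R) : (forall s, 0 <= f s) -> 0 <= iint f.
Proof.
elim: n f => [|n IH] f f0 /=; first exact: f0.
by apply: integral_ge0 => x _; exact: IH.
Qed.

(** The parameter [S] is what allows the induction on [n]: each step turns
    one variable of integration into a parameter. *)
Lemma measurable_iint n (d : measure_display) (S : measurableType d)
    (f : S * n.-tuple R -> \bar R) :
  measurable_fun setT f -> (forall z, 0 <= f z) ->
  measurable_fun setT (fun s => iint (fun v => f (s, v))).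
Proof.
elim: n d S f => [|n IH] d S f mf f0 /=.
  exact: measurable_fun_pair1.
pose h (z : S * R) := iint (fun v : n.-tuple R => f (z.1, [tuple of z.2 :: v])).
have mh : measurable_fun setT h.
  apply: (IH _ _ (fun y : (S * R) * n.-tuple R => f (y.1.1, [tuple of y.1.2 :: y.2]))) => //.
  apply: (measurableT_comp mf); apply: measurable_fun_pair.
    by apply: measurableT_comp.
  by apply: measurable_cons => //; exact: measurableT_comp.
apply: (@measurable_fun_fubini_tonelli_F _ _ _ _ _ mu h) => //.
by move=> z; exact: iint_ge0.
Qed.

Lemma measurable_iint_cons n (f : n.+1.-tuple R -> \bar R) :
  measurable_fun setT f -> (forall s, 0 <= f s) ->
  measurable_fun setT (fun x => iint (fun v => f [tuple of x :: v])).
Proof.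
move=> mf f0; apply: (@measurable_iint n _ _ (fun z : R * n.-tuple R => f [tuple of z.1 :: z.2])) => //.
by apply: (measurableT_comp mf); exact: measurable_cons.
Qed.

Lemma measurable_tuple_cons n (x : R) (f : n.+1.-tuple R -> \bar R) :
  measurable_fun setT f -> measurable_fun setT (fun v : n.-tuple R => f [tuple of x :: v]).
Proof.
by move=> mf; apply: (measurableT_comp mf); apply: measurable_cons => //;
  exact: measurable_cst.
Qed.

Lemma le_iint n (f g : n.-tuple R -> \bar R) :
  measurable_fun setT f -> measurable_fun setT g ->
  (forall s, 0 <= f s) -> (forall s, f s <= g s) -> iint f <= iint g.
Proof.
elim: n f g => [|n IH] f g mf mg f0 fg /=; first exact: fg.
have g0 s : 0 <= g s by exact: le_trans (fg s).
apply: ge0_le_integral => //.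
- by move=> x _; exact: iint_ge0.
- exact: measurable_iint_cons.
- exact: measurable_iint_cons.
- by move=> x _; apply: IH => //; exact: measurable_tuple_cons.
Qed.

Lemma ge0_iint_lin n (f g : n.-tuple R -> \bar R) (k : R) : (0 <= k)%R ->
  measurable_fun setT f -> measurable_fun setT g ->
  (forall s, 0 <= f s) -> (forall s, 0 <= g s) ->
  iint (fun s => k%:E * f s + g s) = k%:E * iint f + iint g.
Proof.
move=> k0; elim: n f g => [//|n IH] f g mf mg f0 g0 /=.
transitivity (\int[mu]_x (k%:E * iint (fun v : n.-tuple R => f [tuple of x :: v])
    + iint (fun v : n.-tuple R => g [tuple of x :: v]))).
  by apply: eq_integral => x _; apply: IH => //; exact: measurable_tuple_cons.
rewrite ge0_integralD//.
- by rewrite ge0_integralZl_EFin//; [move=> x _; exact: iint_ge0|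
    exact: measurable_iint_cons].
- by move=> x _; rewrite mule_ge0// iint_ge0.
- by apply: measurable_funeM; exact: measurable_iint_cons.
- by move=> x _; exact: iint_ge0.
- exact: measurable_iint_cons.
Qed.

Lemma cvg_iint n (F : nat -> n.-tuple R -> \bar R) (f : n.-tuple R -> \bar R) :
  (forall k, measurable_fun setT (F k)) -> (forall k s, 0 <= F k s) ->
  (forall s, nondecreasing_seq (F ^~ s)) ->
  (forall s, F k s @[k --> \oo] --> f s) ->
  iint (F k) @[k --> \oo] --> iint f.
Proof.
elim: n F f => [|n IH] F f mF F0 ndF Ff /=; first exact: Ff.
have E : (\int[mu]_x iint (fun v : n.-tuple R => f [tuple of x :: v])) =
  \int[mu]_x limn (fun k => iint (fun v : n.-tuple R => F k [tuple of x :: v])).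
  apply: eq_integral => x _; apply/esym/cvg_lim => //.
  by apply: IH => // k; exact: measurable_tuple_cons.
rewrite E; apply: cvg_monotone_convergence => //.
- by move=> k; exact: measurable_iint_cons.
- by move=> k x _; exact: iint_ge0.
- move=> x _ a b ab; apply: le_iint => //; try exact: measurable_tuple_cons.
  by move=> s; exact: ndF.
Qed.

End iint.

Section density.
Context {R : realType} {disp : measure_display} {Omega : measurableType disp}
  {P : probability Omega R} {n : nat}.
Variables (X : {RV P >-> n.-tuple R}) (p : n.-tuple R -> R).
Hypotheses (Xp : has_density X p) (mp : measurable_fun setT p)
  (p0 : forall s, 0 <= p s).

(** The density hypothesis, given on measurable sets only, extends to nonnegative
    measurable functions. *)
Lemma density_ge0_integral (f : n.-tuple R -> R) :
  measurable_fun setT f -> (forall s, 0 <= f s) ->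
  (\int[P]_w (f (X w))%:E = iint (fun s => (p s * f s)%:E))%E.
Proof.
move: f; apply: nonneg_measurable_ind.
- move=> A mA; rewrite -Xp// /distribution/= /pushforward.
  rewrite -[in RHS](setIT (X @^-1` A)) -integral_indic//.
  by rewrite -[X @^-1` A]setTI; exact: measurable_funP.
- move=> k f g k0 mf mg f0 g0 Cf Cg.
  have mfX : measurable_fun setT (fun w => (f (X w))%:E).
    by apply/measurable_EFinP; apply: measurableT_comp.
  have mgX : measurable_fun setT (fun w => (g (X w))%:E).
    by apply/measurable_EFinP; apply: measurableT_comp.
  under eq_integral do rewrite EFinD EFinM.
  rewrite ge0_integralD//; first 1 last.
  + by move=> w _; rewrite mule_ge0// lee_fin.
  + exact: measurable_funeM.
  + by move=> w _; rewrite lee_fin.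
  rewrite ge0_integralZl_EFin//; last by move=> w _; rewrite lee_fin.
  rewrite Cf Cg -ge0_iint_lin//.
  + by congr iint; apply/funext => s; rewrite -EFinM -EFinD; congr EFin; ring.
  + by apply/measurable_EFinP; exact: measurable_funM.
  + by apply/measurable_EFinP; exact: measurable_funM.
  + by move=> s; rewrite lee_fin mulr_ge0.
  + by move=> s; rewrite lee_fin mulr_ge0.
- move=> F f mF F0 ndF mf Ff CF.
  have L1 : (\int[P]_w (F k (X w))%:E @[k --> \oo] --> \int[P]_w (f (X w))%:E)%E.
    rewrite (_ : \int[P]_w (f (X w))%:E = \int[P]_w limn (fun k => (F k (X w))%:E))%E; last first.
      apply: eq_integral => w _; apply/esym/cvg_lim => //.
      by apply: cvg_EFin; [exact: nearW|exact: Ff].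
    apply: cvg_monotone_convergence => //.
    + by move=> k; apply/measurable_EFinP; apply: measurableT_comp.
    + by move=> k w _; rewrite lee_fin.
    + by move=> w _ a b ab; rewrite lee_fin; exact: ndF.
  have L2 : (iint (fun s => (p s * F k s)%:E) @[k --> \oo] --> iint (fun s => (p s * f s)%:E))%E.
    apply: cvg_iint.
    + by move=> k; apply/measurable_EFinP; exact: measurable_funM.
    + by move=> k s; rewrite lee_fin mulr_ge0.
    + by move=> s a b ab; rewrite lee_fin ler_wpM2l//; exact: ndF.
    + move=> s; apply: cvg_EFin; first exact: nearW.
      by apply: cvgM; [exact: cvg_cst|exact: Ff].
  have E : (fun k => \int[P]_w (F k (X w))%:E)%E = (fun k => iint (fun s => (p s * F k s)%:E)).
    by apply/funext => k; exact: CF.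
  by rewrite E in L1; exact: (cvg_unique _ L1 L2).
Qed.

Lemma density_mass1 : iint (fun s => (p s)%:E) = 1%E.
Proof.
have := @density_ge0_integral (fun=> 1 : R) (measurable_cst _) (fun=> ler01).
rewrite integral_cst//= probability_setT mule1.
by under eq_fun do rewrite mulr1.
Qed.

(** The mean of [f X] when the density of [X] is proportional to [w]. The
    constant [k] and the mass [Z] of [w] cancel. *)
Lemma density_integral (w f : n.-tuple R -> R) (M k Z v : R) :
  (forall s, p s = k * w s) -> measurable_fun setT f -> (forall s, `|f s| <= M) ->
  has_iint w Z -> has_iint (fun s => w s * f s) (Z * v) ->
  \int[P]_w f (X w) = v.
Proof.
move=> pw mf fM HZ Hv.
have M0 : 0 <= M by apply: le_trans (fM [tuple of nseq n 0]).
(* The density [k * w] has total mass [1]. *)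
have kZ : k * Z = 1.
  have := has_iint_iint (has_iintZ k HZ).
  under eq_fun do rewrite -pw.
  by rewrite density_mass1 => -[].
have fi : P.-integrable setT (EFin \o (fun w => f (X w))).
  apply: (@le_integrable _ _ _ P _ _ _ (EFin \o cst M)) => //.
  - apply/measurable_EFinP.
    exact: (measurableT_comp mf (@measurable_funPT _ _ _ _ X)).
  - by move=> x _; rewrite /= lee_fin (le_trans (fM _))// ler_norm.
  - exact: finite_measure_integrable_cst.
(* [f + M] is nonnegative, and the contribution of the constant is known. *)
have := @density_ge0_integral (fun s => f s + M).
have H1 := has_iintZ k (has_iint_lin 1 Hv (has_iintZ M HZ)).
rewrite (_ : k * _ = v + M) in H1; last first.
  by rewrite mul1r mulrDr mulrA kZ mulrCA kZ; ring.
rewrite (_ : (fun s => (p s * (f s + M))%:E) = (fun s => (k * (1 * (w s * f s) + M * w s))%:E)); last first.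
  by apply/funext => s; rewrite pw; congr EFin; ring.
rewrite (has_iint_iint H1) => H2.
have {}H2 : \int[P]_w (f (X w) + M) = v + M.
  rewrite /Rintegral H2//; first exact: measurable_funD.
  by move=> s; have := fM s; rewrite ler_norml => /andP[]; lra.
move: H2; rewrite RintegralD//; last exact: finite_measure_integrable_cst.
by rewrite Rintegral_cst//= probability_setT mulr1 => /addIr.
Qed.

End density.

(** * Bounded functions of independent random variables *)

(** [f] is a bounded function. *)
Definition bounded_by {T : Type} {R : realType} (f : T -> R) : Prop :=
  exists M, forall x, `|f x| <= M.

Section bounded.
Context {R : realType}.

Lemma bounded_byM (T : Type) (f g : T -> R) :
  bounded_by f -> bounded_by g -> bounded_by (fun x => f x * g x).
Proof.
move=> [M fM] [N gN]; exists (M * N) => x; rewrite normrM.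
by apply: ler_pM.
Qed.

Lemma bounded_byD (T : Type) (f g : T -> R) :
  bounded_by f -> bounded_by g -> bounded_by (fun x => f x + g x).
Proof.
move=> [M fM] [N gN]; exists (M + N) => x.
by rewrite (le_trans (ler_normD _ _))// lerD.
Qed.

Lemma bounded_by_cst (T : Type) (k : R) : bounded_by (fun _ : T => k).
Proof. by exists `|k|. Qed.

Lemma bounded_by_sum (T I : Type) (s : seq I) (F : I -> T -> R) :
  (forall i, bounded_by (F i)) -> bounded_by (fun x => \sum_(i <- s) F i x).
Proof.
move=> H; elim: s => [|i s IH].
  by under eq_fun do rewrite big_nil; exact: bounded_by_cst.
by under eq_fun do rewrite big_cons; exact: bounded_byD.
Qed.

Lemma bounded_by_prod (T I : Type) (s : seq I) (Q : pred I) (F : I -> T -> R) :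
  (forall i, bounded_by (F i)) -> bounded_by (fun x => \prod_(i <- s | Q i) F i x).
Proof.
move=> H; elim: s => [|i s IH].
  by under eq_fun do rewrite big_nil; exact: bounded_by_cst.
by case Qi: (Q i); under eq_fun do rewrite big_cons Qi; [exact: bounded_byM|].
Qed.

Lemma bounded_byX (T : Type) (f : T -> R) n :
  bounded_by f -> bounded_by (fun x => f x ^+ n).
Proof.
move=> H; elim: n => [|n IH]; first exact: bounded_by_cst.
by under eq_fun do rewrite exprS; exact: bounded_byM.
Qed.

Lemma bounded_by_indic (T : Type) (A : set T) : bounded_by (\1_A : T -> R).
Proof. by exists 1 => x; rewrite indicE; case: (_ \in _); rewrite ?normr1 ?normr0. Qed.

Lemma bounded_by_comp (S T : Type) (f : T -> R) (h : S -> T) :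
  bounded_by f -> bounded_by (fun x => f (h x)).
Proof. by move=> [M fM]; exists M. Qed.

(** Induction on bounded measurable functions: indicators, linear
    combinations, and bounded pointwise limits. *)
Lemma bounded_measurable_ind (d : measure_display) (T : measurableType d)
    (C : (T -> R) -> Prop) :
  (forall A, measurable A -> C \1_A) ->
  (forall (k : R) (f g : T -> R), measurable_fun setT f -> measurable_fun setT g ->
    bounded_by f -> bounded_by g -> C f -> C g -> C (fun x => k * f x + g x)) ->
  (forall (F : nat -> T -> R) (f : T -> R) (M : R),
    (forall n, measurable_fun setT (F n)) ->
    measurable_fun setT f -> (forall n x, `|F n x| <= M) -> (forall x, `|f x| <= M) ->
    (forall x, F n x @[n --> \oo] --> f x) ->
    (forall n, C (F n)) -> C f) ->
  forall f : T -> R, measurable_fun setT f -> bounded_by f -> C f.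
Proof.
move=> Cind Clin Clim.
have pos (f : T -> R) : measurable_fun setT f -> (forall x, 0 <= f x) ->
    bounded_by f -> C f.
  move: f; apply: nonneg_measurable_ind.
  - by move=> A mA _; exact: Cind.
  - move=> k f g k0 mf mg f0 g0 Cf Cg [M kM].
    have bg : bounded_by g.
      exists M => x; apply: le_trans (kM x).
      by rewrite !ger0_norm ?addr_ge0 ?mulr_ge0// lerDr mulr_ge0.
    have [->|k_neq0] := eqVneq k 0.
      by under eq_fun do rewrite mul0r add0r; exact: Cg.
    have kp : 0 < k by rewrite lt_neqAle eq_sym k_neq0.
    have bf : bounded_by f.
      exists (M / k) => x; rewrite ler_pdivlMr// mulrC.
      apply: le_trans (kM x).
      by rewrite !ger0_norm ?addr_ge0 ?mulr_ge0// lerDl.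
    by apply: Clin => //; [exact: Cf|exact: Cg].
  - move=> F f mF F0 ndF mf Ff CF [M fM].
    have Fle n x : F n x <= f x.
      rewrite -(cvg_lim (@Rhausdorff R) (Ff x)).
      by apply: nondecreasing_cvgn_le => //; apply/cvg_ex; exists (f x); exact: Ff.
    have FM n x : `|F n x| <= M.
      by rewrite ger0_norm// (le_trans (Fle n x))// (le_trans (ler_norm _)).
    by apply: (Clim F f M) => // n; apply: CF; exists M.
move=> f mf [M fM].
(* [f] differs from a nonnegative function by a multiple of an indicator. *)
rewrite (_ : f = fun x => - M * \1_setT x + (f x + M)); last first.
  by apply/funext => x; rewrite indicT mulr1; ring.
have mfM : measurable_fun setT (fun x => f x + M) by exact: measurable_funD.
have bfM : bounded_by (fun x => f x + M).
  by apply: bounded_byD; [exists M|exact: bounded_by_cst].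
apply: Clin => //; [exact: bounded_by_indic|exact: Cind|].
by apply: pos => // x; have := fM x; rewrite ler_norml => /andP[]; lra.
Qed.

End bounded.

Section probability_integrals.
Context {R : realType} {disp : measure_display} {Omega : measurableType disp}
  (P : probability Omega R).

Lemma bounded_integrable (f : Omega -> R) : measurable_fun setT f -> bounded_by f ->
  P.-integrable setT (EFin \o f).
Proof.
move=> mf [M fM]; apply: (@le_integrable _ _ _ P _ _ _ (EFin \o cst M)) => //.
- exact/measurable_EFinP.
- by move=> x _; rewrite /= lee_fin (le_trans (fM _))// ler_norm.
- exact: finite_measure_integrable_cst.
Qed.

Lemma bounded_cvg_Rintegral (F : nat -> Omega -> R) (f : Omega -> R) (M : R) :
  (forall n, measurable_fun setT (F n)) -> measurable_fun setT f ->
  (forall n x, `|F n x| <= M) -> (forall x, F n x @[n --> \oo] --> f x) ->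
  \int[P]_w F n w @[n --> \oo] --> \int[P]_w f w.
Proof.
move=> mF mf FM Ff.
have E x : (F n x)%:E @[n --> \oo] --> (f x)%:E.
  by apply: cvg_EFin; [exact: nearW|exact: Ff].
have [fi _ C] := @dominated_convergence _ _ _ P setT measurableT
  (fun n x => (F n x)%:E) (fun x => (f x)%:E) (EFin \o cst M)
  (fun n => (measurable_EFinP _ _).2 (mF n)) ((measurable_EFinP _ _).2 mf)
  (aeW P (fun x _ => E x)) (finite_measure_integrable_cst P M measurableT)
  (aeW P (fun x n _ => FM n x)).
apply: fine_cvg; rewrite fineK//; exact: integrable_fin_num.
Qed.

Lemma Rintegral_indic_comp (d : measure_display) (T : measurableType d)
    (X : Omega -> T) (A : set T) : measurable_fun setT X -> measurable A ->
  \int[P]_w \1_A (X w) = fine (P (X @^-1` A)).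
Proof.
move=> mX mA; rewrite /Rintegral; congr fine.
rewrite -[in RHS](setIT (X @^-1` A)) -integral_indic//.
by rewrite -[X @^-1` A]setTI; exact: mX.
Qed.

(** Linearity and bounded convergence propagate a product rule from the
    indicators to all bounded measurable functions of [X]. *)
Lemma Rintegral_product_rule (d : measure_display) (T : measurableType d)
    (X : Omega -> T) (H : Omega -> R) (K : R) :
  measurable_fun setT X -> measurable_fun setT H -> bounded_by H ->
  (forall A, measurable A ->
    \int[P]_w (\1_A (X w) * H w) = \int[P]_w \1_A (X w) * K) ->
  forall h : T -> R, measurable_fun setT h -> bounded_by h ->
    \int[P]_w (h (X w) * H w) = \int[P]_w h (X w) * K.
Proof.
move=> mX mH bH Hind; apply: bounded_measurable_ind => //.
- move=> k f g mf mg bf bg Cf Cg.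
  have mfX : measurable_fun setT (fun w => f (X w)) by exact: measurableT_comp mf mX.
  have mgX : measurable_fun setT (fun w => g (X w)) by exact: measurableT_comp mg mX.
  have bfX : bounded_by (fun w => f (X w)) by exact: bounded_by_comp.
  have bgX : bounded_by (fun w => g (X w)) by exact: bounded_by_comp.
  have ifH : P.-integrable setT (EFin \o (fun w => f (X w) * H w)).
    by apply: bounded_integrable; [exact: measurable_funM|exact: bounded_byM].
  have igH : P.-integrable setT (EFin \o (fun w => g (X w) * H w)).
    by apply: bounded_integrable; [exact: measurable_funM|exact: bounded_byM].
  have kf (h : Omega -> R) : measurable_fun setT h -> bounded_by h ->
    P.-integrable setT (EFin \o (fun w => k * h w)).
    move=> mh bh; apply: bounded_integrable; first exact: measurable_funM.
    by apply: bounded_byM => //; exact: bounded_by_cst.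
  transitivity (\int[P]_w (k * (f (X w) * H w) + g (X w) * H w)).
    by apply: eq_Rintegral => w _; ring.
  rewrite RintegralD//; last first.
    by apply: kf; [exact: measurable_funM|exact: bounded_byM].
  rewrite RintegralD//; [|exact: kf|exact: bounded_integrable].
  rewrite !RintegralZl//; last exact: bounded_integrable.
  by rewrite Cf Cg; ring.
- move=> F f M mF mf FM fM Ff CF.
  have [N HN] := bH.
  have L1 : \int[P]_w (F n (X w) * H w) @[n --> \oo] --> \int[P]_w (f (X w) * H w).
    apply: (@bounded_cvg_Rintegral _ _ (M * N)).
    + by move=> n; apply: measurable_funM => //; exact: measurableT_comp (mF n) mX.
    + by apply: measurable_funM => //; exact: measurableT_comp mf mX.
    + by move=> n w; rewrite normrM; apply: ler_pM.
    + by move=> w; apply: cvgM; [exact: Ff|exact: cvg_cst].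
  have L2 : \int[P]_w F n (X w) @[n --> \oo] --> \int[P]_w f (X w).
    apply: (@bounded_cvg_Rintegral _ _ M) => //.
    + by move=> n; exact: measurableT_comp (mF n) mX.
    + exact: measurableT_comp mf mX.
  have L3 : \int[P]_w (F n (X w) * H w) @[n --> \oo] --> \int[P]_w f (X w) * K.
    have -> : (fun n => \int[P]_w (F n (X w) * H w)) = (fun n => \int[P]_w F n (X w) * K).
      by apply/funext => n; exact: CF.
    by apply: cvgM L2 _; exact: cvg_cst.
  exact: (cvg_unique (@Rhausdorff R) L1 L3).
Qed.

(** Independence, given on measurable sets, yields the product rule for
    bounded functions; the indicators are replaced one factor at a time. *)
Lemma independent_prod (d0 d1 : measure_display) (T0 : measurableType d0)
    (T1 : measurableType d1) (m : nat) (tau : Omega -> T0) (theta : 'I_m -> Omega -> T1) :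
  measurable_fun setT tau -> (forall k, measurable_fun setT (theta k)) ->
  (forall (A : set T0) (B : 'I_m -> set T1),
    measurable A -> (forall k, measurable (B k)) ->
    P (tau @^-1` A `&` [set w | forall k, B k (theta k w)])
    = (P (tau @^-1` A) * \prod_(k < m) P (theta k @^-1` B k))%E) ->
  forall (f : T0 -> R) (g : 'I_m -> T1 -> R),
    measurable_fun setT f -> bounded_by f ->
    (forall k, measurable_fun setT (g k)) -> (forall k, bounded_by (g k)) ->
  \int[P]_w (f (tau w) * \prod_(k < m) g k (theta k w)) =
  \int[P]_w f (tau w) * \prod_(k < m) \int[P]_w g k (theta k w).
Proof.
move=> mtau mtheta indep f g mf bf mg bg.
have mpre (A : set T0) : measurable A -> measurable (tau @^-1` A).
  by move=> mA; rewrite -[_ @^-1` _]setTI; exact: mtau.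
have mpre1 k (A : set T1) : measurable A -> measurable (theta k @^-1` A).
  by move=> mA; rewrite -[_ @^-1` _]setTI; exact: mtheta.
(* The factors of index at least [j] are still indicators. *)
suff H j : (j <= m)%N -> forall g : 'I_m -> T1 -> R,
    (forall k, measurable_fun setT (g k)) -> (forall k, bounded_by (g k)) ->
    (forall k : 'I_m, (j <= k)%N -> exists2 A, measurable A & g k = \1_A) ->
    \int[P]_w (f (tau w) * \prod_(k < m) g k (theta k w)) =
    \int[P]_w f (tau w) * \prod_(k < m) \int[P]_w g k (theta k w).
  by apply: (H m) => // k; rewrite leqNgt ltn_ord.
have mprod (h : 'I_m -> T1 -> R) (Q : pred 'I_m) : (forall k, measurable_fun setT (h k)) ->
    measurable_fun setT (fun w => \prod_(k < m | Q k) h k (theta k w)).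
  move=> mh; rewrite (_ : (fun w => _) =
    (fun w => \prod_(k <- index_enum 'I_m) if Q k then h k (theta k w) else 1)).
    apply: measurable_prod => k _; case: (Q k) => //.
    exact: measurableT_comp (mh k) (mtheta k).
  by apply/funext => w; rewrite big_mkcond.
have bprod (h : 'I_m -> T1 -> R) (Q : pred 'I_m) : (forall k, bounded_by (h k)) ->
    bounded_by (fun w => \prod_(k < m | Q k) h k (theta k w)).
  by move=> bh; apply: bounded_by_prod => k; exact: bounded_by_comp.
elim: j => [_|j IH jm] {}g {}mg {}bg gind.
  have [B mB gB] : exists2 B : 'I_m -> set T1, forall k, measurable (B k) &
      forall k, g k = \1_(B k).
    have [B HB] := choice (fun k => (let: ex_intro2 A mA gA := gind k (leq0n k)
      in ex_intro (fun A => measurable A /\ g k = \1_A) A (conj mA gA))).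
    by exists B => k; have [] := HB k.
  apply: (@Rintegral_product_rule _ _ tau (fun w => \prod_(k < m) g k (theta k w))
    (\prod_(k < m) \int[P]_w g k (theta k w))) => //.
  + exact: mprod.
  + exact: bprod.
  move=> A mA; rewrite Rintegral_indic_comp//.
  transitivity (fine (P (tau @^-1` A `&` [set w | forall k, B k (theta k w)]))).
    have mS : measurable (tau @^-1` A `&` [set w | forall k, B k (theta k w)]).
      apply: measurableI; first exact: mpre.
      rewrite (_ : [set w | _] = \bigcap_k (theta k @^-1` B k)).
        by apply: fin_bigcap_measurable => // k _; exact: mpre1.
      by apply/seteqP; split => w /= Bw k; [move=> _; exact: Bw|exact: Bw].
    have <- := @Rintegral_indic_comp _ _ id _ (@measurable_id _ _ setT) mS.
    apply: eq_Rintegral => w _.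
    rewrite !indicE in_setI -mulnb natrM; congr (_ * _).
    have [wB|wB] := boolP (w \in _).
      rewrite big1// => k _; rewrite gB indicE mem_set//.
      by move/set_mem: wB; exact.
    have [k wk] : exists k, ~ B k (theta k w).
      by apply/existsNP => wB'; move/negP: wB; apply; apply/mem_set.
    by rewrite (bigD1 k)//= gB indicE memNset// mul0r.
  have PE : (\prod_(k < m) P (theta k @^-1` B k) =
      (\prod_(k < m) \int[P]_w g k (theta k w))%:E)%E.
    rewrite (big_morph EFin (@EFinM R) erefl); apply: eq_bigr => k _.
    by rewrite gB Rintegral_indic_comp// fineK// fin_num_measure//; exact: mpre1.
  by rewrite indep// PE fineM// fin_num_measure//; exact: mpre.
pose k0 := Ordinal jm.
have E (u : 'I_m -> R) : \prod_(k < m) u k = u k0 * \prod_(k < m | k != k0) u k.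
  by rewrite (bigD1 k0).
under eq_Rintegral => w _ do rewrite E mulrCA.
rewrite E mulrCA.
apply: (@Rintegral_product_rule _ _ (theta k0)
   (fun w => f (tau w) * \prod_(k < m | k != k0) g k (theta k w))
   (\int[P]_w f (tau w) * \prod_(k < m | k != k0) \int[P]_w g k (theta k w))) => //.
- by apply: measurable_funM; [exact: measurableT_comp mf mtau|exact: mprod].
- by apply: bounded_byM; [exact: bounded_by_comp|exact: bprod].
move=> A mA.
(* The factor of index [j] is an indicator again in [g']. *)
pose g' k := if k == k0 then \1_A : T1 -> R else g k.
have := IH (ltnW jm) g'.
under eq_Rintegral => w _ do rewrite E mulrCA.
rewrite E mulrCA /g' eqxx.
under eq_Rintegral => w _ do under eq_bigr => k /negbTE -> do [].
under eq_bigr => k /negbTE -> do [].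
apply.
- by move=> k; case: eqP => // _; exact: measurable_indic.
- by move=> k; case: eqP => // _; exact: bounded_by_indic.
- move=> k jk; case: eqVneq => [_|kk0]; first by exists A.
  by apply: gind; rewrite ltn_neqAle jk andbT eq_sym.
Qed.

End probability_integrals.

(** * Powers of a sum of independent products *)

Section sum_expectation.
Context {R : realType} {disp : measure_display} {Omega : measurableType disp}
  (P : probability Omega R).

Lemma Rintegral_sum_bounded (m : nat) (F : 'I_m -> Omega -> R) :
  (forall i, measurable_fun setT (F i)) -> (forall i, bounded_by (F i)) ->
  \int[P]_w \sum_(i < m) F i w = \sum_(i < m) \int[P]_w F i w.
Proof.
move=> mF bF; elim: m F mF bF => [|m IH] F mF bF.
  rewrite big_ord0; under eq_Rintegral do rewrite big_ord0.
  by rewrite Rintegral_cst// mul0r.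
rewrite big_ord_recr/= -IH//; under eq_Rintegral do rewrite big_ord_recr/=.
rewrite RintegralD//; apply: bounded_integrable => //.
- exact: measurable_sum.
- exact: bounded_by_sum.
Qed.

Context (d0 d1 : measure_display) (T0 : measurableType d0) (T1 : measurableType d1)
  (m : nat) (tau : Omega -> T0) (theta : 'I_m -> Omega -> T1).
Hypotheses (mtau : measurable_fun setT tau) (mtheta : forall k, measurable_fun setT (theta k)).
Hypothesis indep : forall (f : T0 -> R) (g : 'I_m -> T1 -> R),
    measurable_fun setT f -> bounded_by f ->
    (forall k, measurable_fun setT (g k)) -> (forall k, bounded_by (g k)) ->
  \int[P]_w (f (tau w) * \prod_(k < m) g k (theta k w)) =
  \int[P]_w f (tau w) * \prod_(k < m) \int[P]_w g k (theta k w).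
Variables (W : T1 -> R) (mu : nat -> R) (T : 'I_m -> T0 -> R).
Hypotheses (mW : measurable_fun setT W) (bW : bounded_by W)
  (muE : forall k e, \int[P]_w W (theta k w) ^+ e = mu e)
  (mT : forall k, measurable_fun setT (T k)) (bT : forall k, bounded_by (T k)).

Lemma measurable_sum_moment (s : seq 'I_m) N :
  measurable_fun setT (fun x => sum_moment mu [seq T k x | k <- s] N) /\
  bounded_by (fun x => sum_moment mu [seq T k x | k <- s] N).
Proof.
elim: s N => [|k s IH] N /=; first by split; [exact: measurable_cst|exact: bounded_by_cst].
split.
  apply: measurable_sum => i; apply: measurable_funM; last exact: (IH _).1.
  apply: measurable_funM => //; apply: measurable_funM => //.
  exact: measurable_funX.
apply: bounded_by_sum => i; apply: bounded_byM; last exact: (IH _).2.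
apply: bounded_byM; last exact: bounded_by_cst.
by apply: bounded_byM; [exact: bounded_by_cst|exact: bounded_byX].
Qed.

(** The expansion of [(\sum_k T_k W_k)^N] over the indices [s]. The exponents
    [e] record the powers of the [W_k] split off so far; they vanish on [s], whose
    terms are still to be expanded. *)
Lemma expect_sum_power (s : seq 'I_m) : uniq s ->
  forall (N : nat) (e : 'I_m -> nat) (f : T0 -> R),
  {in s, forall k, e k = 0%N} -> measurable_fun setT f -> bounded_by f ->
  \int[P]_w (f (tau w) * \prod_(k < m) W (theta k w) ^+ e k *
    (\sum_(k <- s) T k (tau w) * W (theta k w)) ^+ N) =
  \int[P]_w (f (tau w) * sum_moment mu [seq T k (tau w) | k <- s] N) *
    \prod_(k < m) mu (e k).
Proof.
have mWX k e : measurable_fun setT (fun w => W (theta k w) ^+ e).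
  by apply: measurable_funX; exact: measurableT_comp mW (mtheta k).
have bWX k e : bounded_by (fun w => W (theta k w) ^+ e).
  by apply: bounded_byX; exact: bounded_by_comp.
elim: s => [|k s IH] us N e f es mf bf.
  transitivity (\int[P]_w ((f (tau w) * (N == 0)%:R) * \prod_(k < m) W (theta k w) ^+ e k)).
    by apply: eq_Rintegral => w _; rewrite big_nil expr0n; ring.
  rewrite (@indep (fun x => f x * (N == 0)%:R) (fun k x => W x ^+ e k)).
  - by congr (_ * _); apply: eq_bigr => k _; exact: muE.
  - exact: measurable_funM.
  - by apply: bounded_byM => //; exact: bounded_by_cst.
  - by move=> k; exact: measurable_funX.
  - by move=> k; exact: bounded_byX.
have /andP[ks us'] : (k \notin s) && uniq s by [].
have ek : e k = 0%N by apply: es; rewrite inE eqxx.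
(* The exponents once the [i]-th power of the term of index [k] is split off. *)
pose e' i j := if j == k then i else e j.
have prodE i (u : 'I_m -> nat -> R) : (forall j, u j 0%N = 1) ->
    \prod_(j < m) u j (e' i j) = u k i * \prod_(j < m) u j (e j).
  move=> u0; rewrite (bigD1 k)//= [in RHS](bigD1 k)//= /e' eqxx ek u0 mul1r.
  by congr (_ * _); apply: eq_bigr => j /negbTE ->.
have mu0 : mu 0 = 1.
  rewrite -(muE k 0); under eq_Rintegral do rewrite expr0.
  by rewrite Rintegral_cst//= probability_setT mulr1.
pose G i w := 'C(N, i)%:R * (f (tau w) * T k (tau w) ^+ i) *
   \prod_(j < m) W (theta j w) ^+ e' i j *
   (\sum_(j <- s) T j (tau w) * W (theta j w)) ^+ (N - i).
have mfT i : measurable_fun setT (fun x => 'C(N, i)%:R * (f x * T k x ^+ i)).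
  by apply: measurable_funM => //; apply: measurable_funM => //; exact: measurable_funX.
have bfT i : bounded_by (fun x => 'C(N, i)%:R * (f x * T k x ^+ i)).
  apply: bounded_byM; first exact: bounded_by_cst.
  by apply: bounded_byM => //; exact: bounded_byX.
transitivity (\int[P]_w \sum_(i < N.+1) G i w).
  apply: eq_Rintegral => w _; rewrite big_cons addrC exprDn mulr_sumr.
  apply: eq_bigr => i _; rewrite /G (prodE i (fun j e => W (theta j w) ^+ e))//.
  by rewrite -[X in _ * X = _]mulr_natr exprMn; ring.
rewrite Rintegral_sum_bounded; last 2 first.
- move=> i; apply: measurable_funM; first apply: measurable_funM.
  + exact: measurableT_comp (mfT i) mtau.
  + by apply: measurable_prod => j _.
  + apply: measurable_funX; apply: measurable_sum => j; apply: measurable_funM.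
      exact: measurableT_comp (mT j) mtau.
    exact: measurableT_comp mW (mtheta j).
- move=> i; apply: bounded_byM; first apply: bounded_byM.
  + exact: (bounded_by_comp tau (bfT i)).
  + exact: bounded_by_prod.
  + apply: bounded_byX; apply: bounded_by_sum => j; apply: bounded_byM.
      exact: (bounded_by_comp tau (bT j)).
    exact: (bounded_by_comp (theta j) bW).
pose H i w := f (tau w) * ('C(N, i)%:R * T k (tau w) ^+ i * mu i *
   sum_moment mu [seq T j (tau w) | j <- s] (N - i)).
have step i : \int[P]_w G i w = (\int[P]_w H i w) * \prod_(j < m) mu (e j).
  rewrite /G (IH us' (N - i)%N (e' i) (fun x => 'C(N, i)%:R * (f x * T k x ^+ i)))//.
    rewrite (prodE i (fun _ => mu))// mulrA; congr (_ * _).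
    rewrite -RintegralZr//; first by apply: eq_Rintegral => w _; rewrite /H; ring.
    apply: bounded_integrable.
      apply: measurable_funM; first exact: measurableT_comp (mfT i) mtau.
      exact: measurableT_comp (measurable_sum_moment s _).1 mtau.
    apply: bounded_byM; first exact: (bounded_by_comp tau (bfT i)).
    exact: (bounded_by_comp tau (measurable_sum_moment s _).2).
  move=> j js; rewrite /e'; case: eqVneq => [jk|_]; first by rewrite jk (negbTE ks) in js.
  by apply: es; rewrite inE js orbT.
under eq_bigr => i _ do rewrite step.
rewrite -mulr_suml; congr (_ * _).
rewrite -Rintegral_sum_bounded.
- by apply: eq_Rintegral => w _; rewrite /= mulr_sumr.
- move=> i; apply: measurable_funM; first exact: measurableT_comp mf mtau.
  apply: measurable_funM; last exact: measurableT_comp (measurable_sum_moment s _).1 mtau.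
  apply: measurable_funM => //; apply: measurable_funM => //; apply: measurable_funX.
  exact: measurableT_comp (mT k) mtau.
- move=> i; apply: bounded_byM; first exact: bounded_by_comp.
  apply: bounded_byM; last exact: (bounded_by_comp tau (measurable_sum_moment s _).2).
  apply: bounded_byM; last exact: bounded_by_cst.
  apply: bounded_byM; first exact: bounded_by_cst.
  by apply: bounded_byX; exact: bounded_by_comp.
Qed.

End sum_expectation.

(** * The angle and duration densities as weights *)

Section densities.
Context {R : realType}.
Implicit Types (p nu t a x : R) (s : seq R).

Lemma Gamma_ge0 x : 0 <= Gamma x.
Proof.
by apply: Rintegral_ge0 => y _; rewrite mulr_ge0 ?powR_ge0 ?expR_ge0.
Qed.

Lemma forall_bigand k (Q : 'I_k -> bool) :
  [forall j, Q j] = \big[andb/true]_(j < k) Q j.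
Proof. by rewrite big_andE. Qed.

Lemma forall_ord_recl k (Q : 'I_k.+1 -> bool) :
  [forall j, Q j] = Q ord0 && [forall j : 'I_k, Q (lift ord0 j)].
Proof. by rewrite !forall_bigand big_ord_recl. Qed.

Lemma measurable_forall (d : measure_display) (T : measurableType d) k
    (Q : 'I_k -> T -> bool) : (forall j, measurable_fun setT (Q j)) ->
  measurable_fun setT (fun y => [forall j, Q j y]).
Proof.
move=> mQ; under eq_fun do rewrite forall_bigand.
elim: (index_enum _) => [|j r IH].
  by under eq_fun do rewrite big_nil; exact: measurable_cst.
by under eq_fun do rewrite big_cons; exact: measurable_and.
Qed.

Lemma measurable_nth n i : measurable_fun setT (fun s : n.-tuple R => s`_i).
Proof.
have [i_n|ni] := ltnP i n.
  rewrite (_ : (fun s : n.-tuple R => _) = (@tnth n R ^~ (Ordinal i_n))).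
    exact: measurable_tnth.
  by apply/funext => s; rewrite (tnth_nth 0).
by under eq_fun => s do rewrite nth_default ?size_tuple//; exact: measurable_cst.
Qed.

Lemma measurable_sin : measurable_fun setT (@sin R).
Proof. by apply: continuous_measurable_fun; exact: continuous_sin. Qed.

Lemma measurable_cos : measurable_fun setT (@cos R).
Proof. by apply: continuous_measurable_fun; exact: continuous_cos. Qed.

Lemma angle_weightE k p s : size s = k.+1 -> angle_weight p s =
  if [forall j : 'I_k, 0 <= s`_j <= pi] && (0 <= s`_k <= 2 * pi) then
    (\prod_(j < k) sin s`_j `^ (p - j%:R)) * `|sin s`_k| `^ (p - k%:R)
  else 0.
Proof.
elim: k p s => [|k IH] p [//|x s] [sz].
  move: sz; case: s => //= _; rewrite big_ord0 mul1r subr0.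
  suff -> : [forall j : 'I_0, 0 <= [:: x]`_j <= pi] by [].
  by apply/forallP => -[].
have -> : angle_weight p (x :: s) =
    if 0 <= x <= pi then `|sin x| `^ p * angle_weight (p - 1) s else 0.
  by case: s sz.
rewrite forall_ord_recl/= -andbA IH//; case: ifP => xI //=.
case: ifP => _; last by rewrite mulr0.
rewrite big_ord_recl/= subr0 (ger0_norm (sin_ge0_pi xI)) -!mulrA; congr (_ * _).
rewrite -natr1 opprD addrA addrAC; congr (_ * _); apply: eq_bigr => j _.
by rewrite /bump/= add1n -natr1 opprD addrA addrAC.
Qed.

Lemma angle_densityE k nu : exists2 K, 0 <= K & forall a : k.+1.-tuple R,
  @angle_density R k.+2 nu a = K * angle_weight (2 * nu + k.+2%:R - 2) a.
Proof.
exists (Gamma (nu + k.+2%:R / 2) / (2 * pi `^ ((k.+2%:R - 1) / 2) * Gamma (nu + 1 / 2))).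
  by rewrite divr_ge0 ?mulr_ge0 ?Gamma_ge0 ?powR_ge0.
move=> a; rewrite /angle_density (@angle_weightE k) ?size_tuple// !subSS !subn0.
case: ifP => _; last by rewrite mulr0.
rewrite -mulrA; do 2 congr (_ * _).
by congr (_ `^ _); rewrite -addn2 natrD; ring.
Qed.

Lemma measurable_angle_density k nu :
  measurable_fun setT (@angle_density R k.+2 nu).
Proof.
apply: measurable_fun_ifT => //.
- apply: measurable_and.
    apply: measurable_forall => j; apply: measurable_and;
      by apply: measurable_fun_ler => //; exact: measurable_nth.
  by apply: measurable_and; apply: measurable_fun_ler => //; exact: measurable_nth.
- apply: measurable_funM.
    apply: measurable_funM => //; apply: measurable_prod => j _.
    apply: (@measurableT_comp _ _ _ _ _ _ (@powR R ^~ _)).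
      exact: measurable_powR.
    exact: (measurableT_comp measurable_sin (@measurable_nth _ _)).
  apply: (@measurableT_comp _ _ _ _ _ _ (@powR R ^~ _)).
    exact: measurable_powR.
  apply: measurableT_comp => //.
  exact: (measurableT_comp measurable_sin (@measurable_nth _ _)).
Qed.

Lemma bounded_direction (al : nat -> R) s :
  `|direction al s| <= \sum_(i < size s) `|al i|.
Proof.
elim: s al => [|x s IH] al /=; first by rewrite big_ord0 normr0.
rewrite big_ord_recl (le_trans (ler_normD _ _))// lerD//.
  by rewrite normrM ler_piMr// cos_max.
rewrite normrM (le_trans (ler_piMl _ (sin_max x)))// (le_trans (IH _))//.
Qed.

Lemma measurable_direction n (al : nat -> R) :
  measurable_fun setT (fun s : n.-tuple R => direction al s).
Proof.
elim: n al => [|n IH] al.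
  rewrite (_ : (fun s : 0.-tuple R => _) = cst 0); first exact: measurable_cst.
  by apply/funext => s; rewrite tuple0.
rewrite (_ : (fun s : n.+1.-tuple R => _) = (fun s : n.+1.-tuple R => al 0%N * cos s`_0 +
    sin s`_0 * direction (fun i => al i.+1) [tuple of behead s])); last first.
  by apply/funext => -[[|x s]].
have mn := @measurable_nth n.+1 0.
apply: measurable_funD; apply: measurable_funM => //.
- exact: (measurableT_comp measurable_cos mn).
- exact: (measurableT_comp measurable_sin mn).
- exact: (measurableT_comp (IH _) (@measurable_behead _ _ _)).
Qed.

(** The durations [s] are positive and leave a positive last one. *)
Definition in_simplex n t (s : n.-tuple R) : bool :=
  [forall j : 'I_n, 0 < tnth s j] && (\sum_(j < n) tnth s j < t).

Lemma in_simplexE n t (s : n.-tuple R) :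
  in_simplex t s = all (> 0) s && (\sum_(x <- s) x < t).
Proof.
rewrite /in_simplex big_tuple; congr (_ && _).
by apply/forallP/all_tnthP.
Qed.

Lemma durationsE n t (s : n.-tuple R) : durations t s = durations_seq t s :> seq R.
Proof.
rewrite /durations /= -(big_tuple _ _ s xpredT id) /=.
case: s => s _ /=; elim: s t => [|x s IH] t /=; first by rewrite big_nil subr0.
by rewrite big_cons opprD addrA IH.
Qed.

Lemma time_weightE a t s : 0 < t -> time_weight a t s =
  if all (> 0) s && (\sum_(x <- s) x < t) then \prod_(x <- durations_seq t s) x `^ (a - 1)
  else 0.
Proof.
elim: s t => [|x s IH] t t0 /=.
  by rewrite big_nil t0 big_seq1 gtr0_norm.
have [/andP[x0 xt]|xI] := boolP (0 < x < t).
  rewrite x0 IH ?subr_gt0// !big_cons ltrBrDl (gtr0_norm x0)/=.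
  by case: ifP => _; rewrite ?mulr0.
case: ifP => // /andP[/andP[x0 s0]]; rewrite big_cons => xst; case/negP: xI.
rewrite x0 (le_lt_trans _ xst)// lerDl big_seq; apply: sumr_ge0 => y ys.
by apply: ltW; exact: (allP s0).
Qed.

Lemma times_densityE d n nu t : 0 < t -> exists2 K, 0 <= K & forall s : n.-tuple R,
  times_density d nu t s = K * time_weight (2 * nu + d%:R - 1) t s.
Proof.
move=> t0; set a := 2 * nu + d%:R - 1.
exists (Gamma (n.+1%:R * a) / Gamma a ^+ n.+1 / t `^ (n.+1%:R * a - 1)).
  by rewrite !divr_ge0 ?Gamma_ge0 ?powR_ge0// exprn_ge0 ?Gamma_ge0.
move=> s; rewrite /times_density -/a time_weightE// -in_simplexE /in_simplex.
case: ifP => _; last by rewrite mulr0.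
rewrite -durationsE big_tuple.
have -> : a - 1 = 2 * nu + d%:R - 2 by rewrite /a; ring.
by rewrite mulrA mulrAC.
Qed.

Lemma measurable_in_simplex n t : measurable_fun setT (@in_simplex n t).
Proof.
apply: measurable_and.
  apply: measurable_forall => j; apply: measurable_fun_ltr => //; exact: measurable_tnth.
apply: measurable_fun_ltr => //; apply: measurable_sum => j; exact: measurable_tnth.
Qed.

Lemma measurable_durations n t (k : 'I_n.+1) :
  measurable_fun setT (fun s : n.-tuple R => tnth (durations t s) k).
Proof.
rewrite (_ : (fun s : n.-tuple R => _) = (fun s : n.-tuple R =>
    if (k < n)%N then s`_k
    else if (k : nat) == n then t - \sum_(j < n) tnth s j else 0)); last first.
  by apply/funext => s; rewrite (tnth_nth 0) /= nth_rcons size_tuple.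
case: (k < n)%N; first exact: measurable_nth.
case: (_ == n); last exact: measurable_cst.
apply: measurable_funB => //; apply: measurable_sum => j; exact: measurable_tnth.
Qed.

Lemma measurable_times_density d n nu t :
  measurable_fun setT (@times_density R d n nu t).
Proof.
apply: measurable_fun_ifT => //; first exact: measurable_in_simplex.
apply: measurable_funM => //; apply: measurable_funM => //.
apply: measurable_prod => k _.
apply: (@measurableT_comp _ _ _ _ _ _ (@powR R ^~ _)); first exact: measurable_powR.
exact: measurable_durations.
Qed.

End densities.

(** * Moments of the flight *)

Section flight_moments.
Context {R : realType} {disp : measure_display} {Omega : measurableType disp}
  {P : probability Omega R}.
Variables (k n : nat) (nu t : R) (tau : {RV P >-> n.-tuple R})
  (theta : 'I_n.+1 -> {RV P >-> (k.+2.-1).-tuple R}).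
Hypotheses (nu0 : 0 <= nu) (t0 : 0 < t) (hf : random_flight nu t tau theta).

(** The parameter of the Dirichlet durations, in dimension [k + 2]. *)
Let a : R := 2 * nu + k.+2%:R - 1.

Let a1 : 1 <= a.
Proof.
by rewrite /a -(addn2 k) natrD; have := ler0n R k; have := nu0; lra.
Qed.

Lemma bounded_direction_tuple (al : nat -> R) :
  bounded_by (fun s : k.+1.-tuple R => direction al s).
Proof.
exists (\sum_(i < k.+1) `|al i|) => s.
by have := bounded_direction al s; rewrite size_tuple.
Qed.

Lemma angle_moment (al : nat -> R) j e :
  \int[P]_w direction al (theta j w) ^+ e =
  mom ((a + 1) / 2) (\sum_(i < k.+1) al i ^+ 2) e.
Proof.
have [K K0 HK] := @angle_densityE R k nu.
set p := 2 * nu + k.+2%:R - 2 in HK.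
have pk : 0 <= p - k%:R.
  by rewrite /p -(addn2 k) natrD; have := nu0; lra.
have [Z HZ] := angle_weight_moments pk.
have -> : (a + 1) / 2 = (p + 2) / 2 by rewrite /a /p; field.
have [M HM] := bounded_byX e (bounded_direction_tuple al).
have H0 := HZ al 0%N; rewrite mom0 mulr1 in H0.
have p0 s : 0 <= @angle_density R k.+2 nu s.
  rewrite HK; apply: mulr_ge0 => //; rewrite (@angle_weightE _ k) ?size_tuple//.
  case: ifP => // _; rewrite mulr_ge0 ?powR_ge0// prodr_ge0// => i _.
  exact: powR_ge0.
have mf : measurable_fun setT (fun s : k.+1.-tuple R => direction al s ^+ e).
  by apply: measurable_funX; exact: measurable_direction.
have {}H0 : has_iint (fun s : k.+1.-tuple R => angle_weight p s) Z.
  by move: H0; under eq_fun do rewrite expr0 mulr1.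
exact: (density_integral (flight_angles hf j) (measurable_angle_density nu) p0 HK mf HM H0 (HZ al e)).
Qed.

(** The [j]-th duration, set to [0] off the simplex in order to be bounded. *)
Definition duration (j : 'I_n.+1) (s : n.-tuple R) : R :=
  if in_simplex t s then tnth (durations t s) j else 0.

Lemma measurable_duration j : measurable_fun setT (duration j).
Proof.
apply: measurable_fun_ifT => //; first exact: measurable_in_simplex.
exact: measurable_durations.
Qed.

Lemma bounded_duration j : bounded_by (duration j).
Proof.
exists t => s; rewrite /duration; case: ifP => [/andP[/forallP s0 st]|_];
  last by rewrite normr0 ltW.
have d0 i : 0 <= tnth (durations t s) i.
  rewrite (tnth_nth 0) /= nth_rcons size_tuple.
  case: ifPn => [i_n|_]; first by rewrite -(tnth_nth 0 s (Ordinal i_n)) ltW.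
  by case: ifP => // _; rewrite subr_ge0 ltW.
rewrite ger0_norm//.
have E : \sum_(i < n.+1) tnth (durations t s) i = t.
  rewrite -(big_tuple _ _ (durations t s) xpredT id) /= -cats1 big_cat big_seq1.
  by rewrite big_tuple /= addrC subrK.
by rewrite -[leRHS]E (bigD1 j)//= lerDl sumr_ge0.
Qed.

Lemma sum_moment0 (mu : nat -> R) s : mu 0%N = 1 -> sum_moment mu s 0 = 1.
Proof.
move=> mu0; elim: s => [|x s IH] //=.
by rewrite big_ord_recl big_ord0 /= bin0 expr0 mu0 IH !mulr1 addr0.
Qed.

Lemma times_density_ge0 (s : n.-tuple R) : 0 <= times_density k.+2 nu t s.
Proof.
have [K K0 ->] := @times_densityE R k.+2 n nu t t0; apply: mulr_ge0 => //.
rewrite time_weightE//; case: ifP => // _.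
by apply: prodr_ge0 => x _; exact: powR_ge0.
Qed.

Lemma time_moment r N :
  \int[P]_w sum_moment (mom ((a + 1) / 2) r) [seq duration j (tau w) | j <- enum 'I_n.+1] N
  = t ^+ N * mom ((n.+1%:R * a + 1) / 2) r N.
Proof.
have [K K0 HK] := @times_densityE R k.+2 n nu t t0; rewrite -/a in HK.
have [Z HZ] := time_weight_moments n a1.
set mu := mom _ r.
have [mS [M HM]] := measurable_sum_moment mu measurable_duration bounded_duration
  (enum 'I_n.+1) N.
(* The truncation of the durations is invisible, as the weight vanishes off
   the simplex. *)
have E (s : n.-tuple R) : time_weight a t s * sum_moment mu [seq duration j s | j <- enum 'I_n.+1] N =
    time_weight a t s * sum_moment mu (durations_seq t s) N.
  rewrite time_weightE// -in_simplexE; case: ifP => sS; last by rewrite !mul0r.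
  congr (_ * sum_moment _ _ _); rewrite -durationsE -[RHS]map_tnth_enum.
  by apply: eq_map => j; rewrite /duration sS.
have H0 := HZ t r 0%N t0; rewrite mom0 expr0 !mulr1 in H0.
apply: (density_integral (flight_times hf) (@measurable_times_density _ _ _ _ _)
  times_density_ge0 HK mS HM (Z := Z * `|t| `^ (n.+1%:R * a - 1))).
- move: H0; congr (has_iint _ _); apply/funext => s.
  by rewrite sum_moment0 ?mulr1 ?mom0.
- have := HZ t r N t0; rewrite !mulrA; congr (has_iint _ _); apply/funext => s.
  by rewrite E.
Qed.

(** The moments of the scalar product of [al] with the position, for speed [1]. *)
Lemma flight_moment (al : nat -> R) N :
  \int[P]_w (\sum_(j < n.+1) duration j (tau w) * direction al (theta j w)) ^+ N
  = t ^+ N * mom ((n.+1%:R * a + 1) / 2) (\sum_(i < k.+1) al i ^+ 2) N.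
Proof.
have mtau : measurable_fun setT tau by exact: measurable_funPT.
have mtheta j : measurable_fun setT (theta j) by exact: measurable_funPT.
rewrite -time_moment.
have := @expect_sum_power _ _ _ P _ _ _ _ _ tau theta mtau mtheta
  (independent_prod mtau mtheta (flight_indep hf)) (direction al)
  (mom ((a + 1) / 2) (\sum_(i < k.+1) al i ^+ 2)) duration
  (@measurable_direction R _ al) (bounded_direction_tuple al)
  (fun j e => angle_moment al j e) measurable_duration bounded_duration
  (enum 'I_n.+1) (enum_uniq _) N (fun=> 0%N) (fun=> 1) (fun _ _ => erefl)
  (measurable_cst _) (bounded_by_cst _ _).
rewrite [X in _ * X](_ : _ = 1); last by rewrite big1// => j _; rewrite mom0.
rewrite mulr1.
under [X in _ = X -> _]eq_Rintegral do rewrite mul1r.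
move=> <-; apply: eq_Rintegral => w _; rewrite mul1r [\prod_(j < _) _]big1 ?mul1r ?big_enum//.
Qed.

Lemma ae_in_simplex : P (tau @^-1` [set s | in_simplex t s]) = 1%E.
Proof.
have mS : measurable [set s : n.-tuple R | in_simplex t s].
  rewrite (_ : [set s | _] = @in_simplex R n t @^-1` [set true]).
    by rewrite -[_ @^-1` _]setTI; exact: measurable_in_simplex.
  by apply/seteqP; split => s.
have := flight_times hf mS; rewrite /distribution /pushforward => ->.
rewrite -(density_mass1 (flight_times hf) (@measurable_times_density _ _ _ _ _)
  times_density_ge0); congr iint; apply/funext => s; congr EFin.
rewrite indicE; case: (boolP (in_simplex t s)) => sS.
  by rewrite mem_set// mulr1.
have nS : ~ [set s | in_simplex t s] s by exact/negP.
by rewrite memNset// mulr0 /times_density -/(in_simplex t s) (negbTE sS).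
Qed.

End flight_moments.

(** * The Gamma function *)

Section gamma.
Context {R : realType}.
Notation mu := (@lebesgue_measure R).
Implicit Types (x s : R).

(** The integrand of [Gamma x], made continuous on the whole line for [1 <= x]. *)
Definition gammaf x s : R := `|s| `^ (x - 1) * expR (- s).

Lemma continuous_expRN : continuous (fun s : R => expR (- s)).
Proof.
move=> s; apply: (@continuous_comp _ _ _ (fun s : R => - s) expR).
  exact: continuousN.
exact: continuous_expR.
Qed.

Lemma continuous_gammaf x : 1 <= x -> continuous (gammaf x).
Proof.
move=> x1 s; apply: cvgM; last exact: continuous_expRN.
by apply: continuous_abs_powR; rewrite subr_ge0.
Qed.

Lemma gammaf_ge0 x s : 0 <= gammaf x s.
Proof. by rewrite mulr_ge0 ?powR_ge0 ?expR_ge0. Qed.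

Lemma series_exp_le_expR n x : 0 <= x -> \sum_(i < n) x ^+ i / i`!%:R <= expR x.
Proof.
move=> x0; rewrite -(big_mkord xpredT (fun i => x ^+ i / i`!%:R)).
apply: (@nondecreasing_cvgn_le _ (series (exp_coeff x))).
  apply/nondecreasing_seqP => k; rewrite /series/= big_nat_recr//= lerDl.
  exact: exp_coeff_ge0.
exact: is_cvg_series_exp_coeff.
Qed.

Lemma exprn_le_expR n x : 0 <= x -> x ^+ n <= n`!%:R * expR x.
Proof.
move=> x0; have := series_exp_le_expR n.+1 x0.
rewrite big_ord_recr/= => H; rewrite mulrC -ler_pdivrMr ?ltr0n ?fact_gt0//.
apply: le_trans H; rewrite lerDr; apply: sumr_ge0 => i _.
by rewrite divr_ge0// exprn_ge0.
Qed.

(** An exponential bound: [s^m <= 2^m m! exp (s / 2)] for an integer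
    [m >= x - 1]. *)
Lemma gammaf_le x : 1 <= x ->
  exists2 C, 0 <= C & forall s, 0 <= s -> gammaf x s <= C * expR (- (s / 2)).
Proof.
move=> x1; pose m := Num.bound (x - 1).
have xm : x - 1 <= m%:R by apply: ltW; apply: archi_boundP; rewrite subr_ge0.
exists (1 + 2 ^+ m * m`!%:R); first by rewrite addr_ge0// mulr_ge0// exprn_ge0.
move=> s s0; have h0 : 0 <= s / 2 by rewrite divr_ge0.
rewrite /gammaf (_ : expR (- s) = expR (- (s / 2)) * expR (- (s / 2))); last first.
  by rewrite -expRD; congr expR; field.
rewrite mulrA ler_pM2r ?expR_gt0//.
have e1 : expR (- (s / 2)) <= 1 by rewrite -[leRHS]expR0 ler_expR oppr_le0.
rewrite (ger0_norm s0); have [s1|s1] := leP s 1.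
  apply: (@le_trans _ _ 1); last by rewrite lerDl mulr_ge0// exprn_ge0.
  rewrite -[leRHS]mulr1 ler_pM ?powR_ge0 ?expR_ge0//.
  have E : 1 = 1 `^ (x - 1) :> R by rewrite powR1.
  by rewrite [leRHS]E ge0_ler_powR ?nnegrE// subr_ge0.
apply: (@le_trans _ _ (2 ^+ m * m`!%:R)); last by rewrite lerDr.
apply: (@le_trans _ _ (s ^+ m * expR (- (s / 2)))).
  rewrite ler_wpM2r ?expR_ge0// -powR_mulrn//; apply: ler_powR => //.
  exact: ltW.
rewrite expRN ler_pdivrMr ?expR_gt0// -mulrA.
have -> : s ^+ m = 2 ^+ m * (s / 2) ^+ m by rewrite -exprMn; congr (_ ^+ _); field.
by rewrite ler_wpM2l ?exprn_ge0//; exact: exprn_le_expR.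
Qed.

Lemma GammaE x : 1 <= x -> Gamma x = fine (\int[mu]_(s in `[0%R, +oo[) (gammaf x s)%:E).
Proof.
move=> x1; rewrite /Gamma /Rintegral; congr fine.
rewrite -integral_itv_obnd_cbnd; last first.
  apply/measurable_EFinP; apply: measurable_funTS.
  by apply: continuous_measurable_fun; exact: continuous_gammaf.
apply: eq_integral => s; rewrite inE/= in_itv/= andbT => s0.
by rewrite /gammaf gtr0_norm.
Qed.

(** The Gamma integral cut at the integer [n]. *)
Let incGamma x (n : nat) : R := \int[mu]_(s in `[0, n%:R]) gammaf x s.

Let gammaf_integrable x (a b : R) : 1 <= x -> mu.-integrable `[a, b] (EFin \o gammaf x).
Proof. by move=> x1; apply: continuous_itv_integrable; exact: continuous_gammaf. Qed.

Let incGamma_EFin x n : 1 <= x -> (\int[mu]_(s in `[0%R, n%:R]) (gammaf x s)%:E = (incGamma x n)%:E)%E.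
Proof.
by move=> x1; rewrite /incGamma /Rintegral fineK//; apply: integrable_fin_num => //;
  exact: gammaf_integrable.
Qed.

Lemma cvg_Gamma x : 1 <= x -> incGamma x n @[n --> \oo] --> Gamma x /\ incGamma x 1 <= Gamma x.
Proof.
move=> x1; have [C C0 HC] := gammaf_le x1.
have mg (A : set R) : measurable_fun A (fun s => (gammaf x s)%:E).
  apply/measurable_EFinP; apply: measurable_funTS.
  by apply: continuous_measurable_fun; exact: continuous_gammaf.
(* The integral of [exp (- s / 2)] over the half-line is [2]. *)
have Ib n : incGamma x n <= C * 2.
  have [->|n0] := eqVneq n 0%N.
    by rewrite /incGamma set_itv1 Rintegral_set1 mulr_ge0.
  have n0' : (0 : R) < n%:R by rewrite ltr0n lt0n.
  have ch : continuous (fun s : R => expR (- (s / 2))).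
    move=> s; apply: (@continuous_comp _ _ _ (fun s => s / 2) (fun s => expR (- s))).
      by apply: cvgM; [exact: cvg_id|exact: cvg_cst].
    exact: continuous_expRN.
  have cC : continuous (fun s : R => C * expR (- (s / 2))).
    by move=> s; apply: cvgM; [exact: cvg_cst|exact: ch].
  apply: (@le_trans _ _ (\int[mu]_(s in `[0, n%:R]) (C * expR (- (s / 2))))).
    apply: le_Rintegral => //; [exact: gammaf_integrable|exact: continuous_itv_integrable|].
    by move=> s; rewrite /= in_itv/= => /andP[s0 _]; exact: HC.
  pose F s := - (C * 2) * expR (- (s / 2)) : R.
  have -> : \int[mu]_(s in `[0, n%:R]) (C * expR (- (s / 2))) = F n%:R - F 0.
    apply: Rintegral_derive => //.
      by move=> s; apply: cvgM; [exact: cvg_cst|exact: ch].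
    move=> s _.
    have D1 : is_derive s 1 (fun s : R => - (s / 2)) (- (1 / 2)).
      have D := is_derive_mul (is_derive_id s 1) (is_derive_cst (- (1 / 2) : R) s 1).
      rewrite (_ : (fun s : R => - (s / 2)) = (fun s => s * - (1 / 2))).
        by apply: (is_derive_eq D); rewrite /= mulr0 addr0 mul1r.
      by apply/funext => y; field.
    have D := is_derive_mul (is_derive_cst (- (C * 2) : R) s 1)
      (@is_derive1_comp _ expR (fun s : R => - (s / 2)) s _ _ (is_derive_expR _) D1).
    by apply: (is_derive_eq D) => /=; field.
  rewrite /F mul0r oppr0 expR0 mulr1 opprK mulNr addrC gerBl.
  by rewrite !mulr_ge0// expR_ge0.
have L : ((incGamma x n)%:E @[n --> \oo] --> \int[mu]_(s in `[0%R, +oo[) (gammaf x s)%:E)%E.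
  have U : `[0%R, +oo[%classic = \bigcup_n (`[(0 : R), n%:R]%classic).
    rewrite (itv_bndy_bigcup_BRight true 0); apply: eq_bigcupr => n _.
    by rewrite add0r.
  rewrite U.
  under eq_cvg do rewrite -incGamma_EFin//.
  apply: ge0_nondecreasing_set_cvg_integral => //.
  - move=> p q pq; apply/subsetPset; apply: subset_itvl; rewrite bnd_simp.
    by rewrite ler_nat.
  - by move=> i; exact: mg.
  - by move=> i s _; rewrite lee_fin gammaf_ge0.
have G0 : (0 <= \int[mu]_(s in `[0%R, +oo[) (gammaf x s)%:E)%E.
  by apply: integral_ge0 => s _; rewrite lee_fin gammaf_ge0.
have Gfin : (\int[mu]_(s in `[0%R, +oo[) (gammaf x s)%:E)%E \is a fin_num.
  rewrite ge0_fin_numE//; apply: (@le_lt_trans _ _ (C * 2)%:E); last exact: ltry.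
  rewrite -(cvg_lim _ L)//; apply: lime_le; first by apply/cvg_ex; eexists; exact: L.
  by apply: nearW => n; rewrite lee_fin.
rewrite GammaE//; split.
  by move: L; rewrite -[X in _ --> X -> _](fineK Gfin) => /fine_cvg.
rewrite -lee_fin -incGamma_EFin// (fineK Gfin); apply: ge0_subset_integral => //.
- exact: mg.
- by move=> s _; rewrite lee_fin gammaf_ge0.
- exact: subset_itvl.
Qed.

Lemma Gamma_gt0 x : 1 <= x -> 0 < Gamma x.
Proof.
move=> x1; have [_] := cvg_Gamma x1; apply: lt_le_trans.
have x0 : 0 < x by exact: lt_le_trans x1.
have cp : continuous (fun s : R => x * `|s| `^ (x - 1)).
  move=> s; apply: cvgM; first exact: cvg_cst.
  by apply: continuous_abs_powR; rewrite subr_ge0.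
have E : \int[mu]_(s in `[0, 1]) (x * `|s| `^ (x - 1)) = 1.
  transitivity (`|1 : R| `^ x - `|0 : R| `^ x); last first.
    by rewrite normr1 normr0 powR1 powR0 ?gt_eqF// subr0.
  apply: (@Rintegral_derive _ _ (fun s : R => `|s| `^ x)) => //.
  - by apply: continuous_abs_powR; exact: ltW.
  - move=> s /andP[s0 _]; have := is_derive_abs_powR x (lt0r_neq0 s0).
    move=> D; apply: (is_derive_eq D).
    by rewrite powRB ?(gt_eqF s0) ?normr_eq0 ?(gt_eqF s0) ?implybT// gtr0_norm// powRr1 ?ltW// mulrA.
pose c := (x * expR 1)^-1.
have k0 : 0 < c by rewrite invr_gt0 mulr_gt0 ?expR_gt0.
apply: (lt_le_trans k0); rewrite -[leLHS]mulr1 -[X in c * X]E -RintegralZl//; last exact: continuous_itv_integrable.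
apply: le_Rintegral => //.
- apply: continuous_itv_integrable => s; apply: cvgM; first exact: cvg_cst.
  exact: cp.
- exact: gammaf_integrable.
move=> s; rewrite /= in_itv/= => /andP[s0 s1].
rewrite /gammaf [leLHS](_ : _ = `|s| `^ (x - 1) * (expR 1)^-1); last first.
  by rewrite /c; field; rewrite !gt_eqF// expR_gt0.
by rewrite ler_wpM2l ?powR_ge0// -expRN ler_expR lerN2.
Qed.

Lemma cvg_gammaf x : 1 <= x -> gammaf x n%:R @[n --> \oo] --> 0.
Proof.
move=> x1; have [C C0 HC] := gammaf_le x1.
apply: (@squeeze_cvgr _ _ _ _ (cst 0) (fun n : nat => C * expR (- (n%:R / 2)))).
- by apply: nearW => n; rewrite gammaf_ge0 HC.
- exact: cvg_cst.
rewrite -(mulr0 C); apply: cvgM; first exact: cvg_cst.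
apply: (@cvg_comp _ _ _ (fun n : nat => n%:R / 2 : R) (fun y => expR (- y)) _ (pinfty_nbhs R)).
  apply/cvgryPge => A; near=> n; rewrite ler_pdivlMr//.
  by near: n; exact: nbhs_infty_ger.
exact: cvgr_expR.
Unshelve. all: by end_near. Qed.

Lemma Gamma_succ x : 1 <= x -> Gamma (x + 1) = x * Gamma x.
Proof.
move=> x1; have x0 : 0 < x by exact: lt_le_trans x1.
have x2 : 1 <= x + 1 by rewrite (le_trans x1)// lerDl.
have E n : x * incGamma x n.+1 - incGamma (x + 1) n.+1 = gammaf (x + 1) n.+1%:R.
  rewrite /incGamma -RintegralZl//; last exact: gammaf_integrable.
  have cx : continuous (fun s => x * gammaf x s).
    by move=> s; apply: cvgM; [exact: cvg_cst|exact: continuous_gammaf].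
  rewrite -RintegralB//; [|exact: continuous_itv_integrable|exact: gammaf_integrable].
  transitivity (gammaf (x + 1) n.+1%:R - gammaf (x + 1) 0); last first.
    by rewrite {2}/gammaf normr0 addrK powR0 ?gt_eqF// mul0r subr0.
  apply: Rintegral_derive => //.
  - by move=> s; apply: cvgB; [exact: cx|exact: continuous_gammaf].
  - exact: continuous_gammaf.
  - move=> s /andP[s0 _]; rewrite /gammaf.
    have D1 : is_derive s 1 (fun s : R => - s) (- 1).
      exact: (is_deriveN (is_derive_id s 1)).
    have D := is_derive_mul (is_derive_abs_powR (x + 1 - 1) (lt0r_neq0 s0))
      (@is_derive1_comp _ expR (fun s : R => - s) s _ _ (is_derive_expR _) D1).
    apply: (is_derive_eq D) => /=; rewrite addrK.
    rewrite powRB ?normr_eq0 ?(gt_eqF s0) ?implybT// gtr0_norm// powRr1 ?ltW//.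
    by field; rewrite gt_eqF.
have L1 : x * incGamma x n.+1 - incGamma (x + 1) n.+1 @[n --> \oo] --> x * Gamma x - Gamma (x + 1).
  apply: cvgB; first apply: cvgM; first exact: cvg_cst.
    by rewrite (cvg_shiftS (incGamma x)); exact: (cvg_Gamma x1).1.
  by rewrite (cvg_shiftS (incGamma (x + 1))); exact: (cvg_Gamma x2).1.
have L2 : x * incGamma x n.+1 - incGamma (x + 1) n.+1 @[n --> \oo] --> 0.
  pose u n := gammaf (x + 1) n%:R.
  rewrite (_ : (fun n => _) = (fun n => u n.+1)); last exact/funext.
  by rewrite (cvg_shiftS u); exact: cvg_gammaf.
have H : x * Gamma x - Gamma (x + 1) = 0 by exact: (cvg_unique (@Rhausdorff R) L1 L2).
by apply/esym/eqP; rewrite -subr_eq0 H.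
Qed.

Lemma Gamma_poch x n : 1 <= x -> Gamma (n%:R + x) = poch x n * Gamma x.
Proof.
move=> x1; elim: n => [|n IH]; first by rewrite add0r poch0 mul1r.
rewrite -natr1 addrAC Gamma_succ ?IH ?pochS; last by rewrite (le_trans x1)// lerDr.
by ring.
Qed.

End gamma.

(** * Characteristic functions from moments, and the Bessel series *)

Section power_series.
Context {R : realType} {disp : measure_display} {Omega : measurableType disp}
  (P : probability Omega R).

(** Term-by-term expectation of a power series with coefficients [b i / i!],
    [b] bounded by [1]; the partial sums are dominated by an exponential. *)
Lemma expect_exp_series (Z : Omega -> R) (b : nat -> R) (F : R -> R) :
  measurable_fun setT Z -> bounded_by Z -> (forall i, `|b i| <= 1) ->
  measurable_fun setT F ->
  (forall x, series (fun i => b i * (x ^+ i / i`!%:R)) @ \oo --> F x) ->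
  series (fun i => b i * (\int[P]_w Z w ^+ i / i`!%:R)) @ \oo --> \int[P]_w F (Z w).
Proof.
move=> mZ [M ZM] b1 mF HF.
pose S N w := \sum_(i < N) b i * (Z w ^+ i / i`!%:R).
have mZi i : measurable_fun setT (fun w => b i * (Z w ^+ i / i`!%:R)).
  by apply: measurable_funM => //; apply: measurable_funM => //; exact: measurable_funX.
have bZi i : bounded_by (fun w => b i * (Z w ^+ i / i`!%:R)).
  apply: bounded_byM; first exact: bounded_by_cst.
  by apply: bounded_byM; [apply: bounded_byX; exists M|exact: bounded_by_cst].
have -> : series (fun i => b i * (\int[P]_w Z w ^+ i / i`!%:R)) =
    (fun N => \int[P]_w S N w).
  apply/funext => N; rewrite /S (Rintegral_sum_bounded _ (fun i => mZi i) (fun i => bZi i)).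
  rewrite /series/= big_mkord; apply: eq_bigr => i _.
  have iZ : P.-integrable setT (EFin \o (fun w => Z w ^+ i)).
    by apply: bounded_integrable; [exact: measurable_funX|apply: bounded_byX; exists M].
  rewrite [LHS](_ : _ = \int[P]_w Z w ^+ i * (b i / i`!%:R)); last by ring.
  rewrite -RintegralZr//; apply: eq_Rintegral => w _; ring.
apply: (@bounded_cvg_Rintegral _ _ _ P S (fun w => F (Z w)) (expR `|M|)).
- by move=> N; apply: measurable_sum => i; exact: mZi.
- exact: measurableT_comp mF mZ.
- move=> N w; apply: le_trans (series_exp_le_expR N (normr_ge0 M)).
  apply: (le_trans (ler_norm_sum _ _ _)); apply: ler_sum => i _.
  rewrite normrM -[leRHS]mul1r ler_pM// normrM normrX normfV (ger0_norm (ler0n _ _)).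
  by rewrite ler_wpM2r ?invr_ge0// lerXn2r ?nnegrE// (le_trans (ZM w))// ler_norm.
- move=> w; have := HF (Z w); rewrite /series/=.
  by under eq_fun do rewrite big_mkord.
Qed.

Lemma expect_sin_odd (Z : Omega -> R) : measurable_fun setT Z -> bounded_by Z ->
  (forall N, odd N -> \int[P]_w Z w ^+ N = 0) -> \int[P]_w sin (Z w) = 0.
Proof.
move=> mZ bZ Zodd.
pose b i : R := (odd i)%:R * (-1) ^+ i.-1./2.
have H := @expect_exp_series Z b sin mZ bZ.
have b1 i : `|b i| <= 1.
  by rewrite /b normrM normrX normrN1 expr1n mulr1; case: odd; rewrite ?normr1 ?normr0.
have Hsin x : series (fun i => b i * (x ^+ i / i`!%:R)) @ \oo --> sin x.
  have E : sin_coeff x = (fun i => b i * (x ^+ i / i`!%:R)).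
    by apply/funext => i; rewrite /sin_coeff/= /b mulrA.
  by rewrite -E sin.unlock; exact: is_cvg_series_sin_coeff.
have {H} := H b1 measurable_sin Hsin.
rewrite (_ : series _ = fun=> 0).
  by move=> L; exact: (cvg_unique (@Rhausdorff R) L (cvg_cst 0)).
apply/funext => N; rewrite /series/= big1// => i _; rewrite /b.
have [oi|ei] := boolP (odd i); first by rewrite Zodd// mul0r mulr0.
by rewrite /= !mul0r.
Qed.

Lemma expect_cos_series (Z : Omega -> R) : measurable_fun setT Z -> bounded_by Z ->
  series (fun k => (-1) ^+ k * (\int[P]_w Z w ^+ k.*2 / k.*2`!%:R)) @ \oo -->
    \int[P]_w cos (Z w).
Proof.
move=> mZ bZ.
pose b i : R := (~~ odd i)%:R * (-1) ^+ i./2.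
have H := @expect_exp_series Z b cos mZ bZ.
have b1 i : `|b i| <= 1.
  by rewrite /b normrM normrX normrN1 expr1n mulr1; case: odd; rewrite ?normr1 ?normr0.
have Hcos x : series (fun i => b i * (x ^+ i / i`!%:R)) @ \oo --> cos x.
  have E : cos_coeff x = (fun i => b i * (x ^+ i / i`!%:R)).
    by apply/funext => i; rewrite /cos_coeff/= /b mulrA.
  by rewrite -E cos.unlock; exact: is_cvg_series_cos_coeff.
have {}H := H b1 measurable_cos Hcos.
have cH : cvgn (series (fun i => b i * (\int[P]_w Z w ^+ i / i`!%:R))).
  by apply/cvg_ex; eexists; exact: H.
(* Grouping the terms in pairs discards the odd ones, which vanish. *)
have G := cvg_series_cvg_series_group cH (isT : (0 < 2)%N).
rewrite (cvg_lim (@Rhausdorff R) H) in G.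
rewrite (_ : (fun n => _) =
    (fun k => (-1) ^+ k * (\int[P]_w Z w ^+ k.*2 / k.*2`!%:R))) in G; first exact: G.
apply/funext => k; rewrite !muln2 big_nat_recr ?leqW// big_nat1 /b /=.
by rewrite odd_double doubleK /= mul1r mul0r mul0r addr0.
Qed.

Lemma ler_norm_sin (x : R) : `|sin x| <= `|x|.
Proof.
wlog x0 : x / 0 <= x => [H|].
  have [/H//|/ltW x0] := leP 0 x.
  by have := H (- x); rewrite sinN !normrN oppr_ge0; exact.
have [|c _] := @MVT_segment R sin cos 0 x x0.
- by apply: continuous_subspaceT; exact: continuous_sin.
rewrite sin0 !subr0 => ->; rewrite normrM ler_piMl//; exact: cos_max.
Qed.

Lemma cos_ge1Bsqr (x : R) : 1 - x ^+ 2 <= cos x.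
Proof.
have -> : cos x = 1 - sin (x / 2) ^+ 2 *+ 2.
  rewrite -{1}[x](_ : (x / 2) *+ 2 = x); last by rewrite mulr2n; field.
  by rewrite cos_mulr2n cos2sin2; ring.
have H : sin (x / 2) ^+ 2 <= (x / 2) ^+ 2.
  by rewrite -(real_normK (num_real (sin _))) -(real_normK (num_real (x / 2)))
    lerXn2r ?nnegrE// ler_norm_sin.
have H2 : 0 <= x ^+ 2 by exact: sqr_ge0.
rewrite lerD2l lerN2 mulr2n (le_trans (lerD H H))// exprMn; lra.
Qed.

End power_series.

Section bessel.
Context {R : realType}.

(** The hypothesis is the form in which the cosine series of the moments arises. *)
Lemma besselJE (h x E : R) : 1 <= h -> 0 < x ->
  series (fun k => (-1) ^+ k * (x ^+ k.*2 * (poch (1 / 2) k / poch h k) / k.*2`!%:R))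
    @ \oo --> E ->
  besselJ (h - 1) x = (x / 2) `^ (h - 1) / Gamma h * E.
Proof.
move=> h1 x0 HE; apply: cvg_lim => //.
have G0 : Gamma h != 0 by rewrite gt_eqF// Gamma_gt0.
rewrite [X in X @ _ --> _](_ : _ = fun N => (x / 2) `^ (h - 1) / Gamma h *
  series (fun k => (-1) ^+ k * (x ^+ k.*2 * (poch (1 / 2) k / poch h k) / k.*2`!%:R)) N).
  by apply: cvgM; [exact: cvg_cst|exact: HE].
apply/funext => N; rewrite /series/= mulr_sumr; apply: eq_bigr => k _.
rewrite -addrA subrK Gamma_poch//.
have x2 : 0 < x / 2 by rewrite divr_gt0.
rewrite [X in _ * X = _]powRD ?(gt_eqF x2) ?implybT// -(natrM _ 2 k) powR_mulrn ?(ltW x2)// mul2n.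
rewrite poch_half_fact exprMn exprVn.
have -> : 2 ^+ k.*2 = 4 ^+ k :> R by rewrite -mul2n exprM -natrX.
field; rewrite G0 !poch_neq0 ?expf_neq0 ?pnatr_eq0 -?lt0n ?fact_gt0//.
exact: lt_le_trans h1.
Qed.

End bessel.

(** * The characteristic function of the projection *)

Section projection.
Context {R : realType}.

Lemma directionE (al : nat -> R) s : direction al s =
  \sum_(i < size s) al i * ((\prod_(j < i) sin s`_j) * cos s`_i).
Proof.
elim: s al => [|x s IH] al /=; first by rewrite big_ord0.
rewrite big_ord_recl big_ord0 mul1r /= IH mulr_sumr; congr (_ + _).
apply: eq_bigr => i _; rewrite /bump/= add1n big_ord_recl/=.
by rewrite (eq_bigr (fun j : 'I_i => sin s`_j)); [ring|move=> j _].
Qed.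

(** The coordinates of [alpha], continued by zeros: the missing coordinates
    of the position then play no role. *)
Definition coord_ext m (alpha : 'rV[R]_m) (i : nat) : R :=
  if insub i is Some j then alpha 0 j else 0.

Lemma coord_ext_ord m (alpha : 'rV[R]_m) (i : 'I_m) : coord_ext alpha i = alpha 0 i.
Proof. by rewrite /coord_ext valK. Qed.

Lemma sum_coord_ext m k (alpha : 'rV[R]_m) (f : nat -> R -> R) : (m <= k)%N ->
  (forall i, f i 0 = 0) ->
  \sum_(i < k) f i (coord_ext alpha i) = \sum_(i < m) f i (alpha 0 i).
Proof.
move=> mk f0; under [RHS]eq_bigr => i _ do rewrite -coord_ext_ord.
rewrite (big_ord_widen k (fun i => f i (coord_ext alpha i)) mk) [RHS]big_mkcond/=.
apply: eq_bigr => i _; case: ifPn => // im.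
by rewrite /coord_ext insubF ?f0//; exact: negbTE.
Qed.

Lemma enorm_sqr m (alpha : 'rV[R]_m) : enorm alpha ^+ 2 = dot alpha alpha.
Proof.
by rewrite sqr_sqrtr//; apply: sumr_ge0 => i _; rewrite -expr2 sqr_ge0.
Qed.

Lemma enorm_gt0 m (alpha : 'rV[R]_m) : alpha != 0 -> 0 < enorm alpha.
Proof.
move=> a0; rewrite sqrtr_gt0 lt_neqAle eq_sym; apply/andP; split; last first.
  by apply: sumr_ge0 => i _; rewrite -expr2 sqr_ge0.
apply: contraNneq a0 => /eqP; rewrite psumr_eq0.
  move=> /allP H; apply/eqP/rowP => i; rewrite mxE.
  by have := H i (mem_index_enum _); rewrite -expr2 sqrf_eq0 => /eqP.
by move=> i _; rewrite -expr2 sqr_ge0.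
Qed.

Lemma cvg_dot m (b : 'rV[R]_m) : dot beta beta @[beta --> b] --> dot b b.
Proof.
have Fb : Filter (nbhs b) by exact: nbhs_filter.
rewrite /dot; elim: (index_enum 'I_m) => [|i r IH].
  rewrite (_ : (fun beta : 'rV[R]_m => _) = cst 0).
    rewrite big_nil; exact: (@cvg_cst R 0 _ (nbhs b) Fb).
  by apply/funext => x; rewrite big_nil.
rewrite (_ : (fun beta : 'rV[R]_m => _) = (fun beta : 'rV[R]_m =>
    beta 0 i * beta 0 i + \sum_(j <- r) beta 0 j * beta 0 j)).
  rewrite big_cons; apply: (@cvgD _ R^o); last exact: IH.
  by apply: cvgM; exact: coord_continuous.
by apply/funext => x; rewrite big_cons.
Qed.

End projection.

Section flight.
Context {R : realType} {disp : measure_display} {Omega : measurableType disp}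
  {P : probability Omega R}.
Variables (k m n : nat) (nu c t : R) (tau : {RV P >-> n.-tuple R})
  (theta : 'I_n.+1 -> {RV P >-> (k.+2.-1).-tuple R}).
Hypotheses (mk : (m <= k.+1)%N) (nu0 : 0 <= nu) (c0 : 0 < c) (t0 : 0 < t)
  (hf : random_flight nu t tau theta).

(** The parameter of the Dirichlet durations, in dimension [k + 2]. *)
Let a : R := 2 * nu + k.+2%:R - 1.
(** The Bessel function of the result has order [h - 1]. *)
Let h : R := (n.+1%:R * a + 1) / 2.

Let a1 : 1 <= a.
Proof.
by rewrite /a -(addn2 k) natrD; have := ler0n R k; have := nu0; lra.
Qed.

Let h1 : 1 <= h.
Proof.
rewrite /h; have : 1 <= n.+1%:R * a by rewrite -[leLHS]mulr1 ler_pM// ler1n.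
lra.
Qed.

(** The projected position. *)
Let X : Omega -> 'rV[R]_m := @flight_projection Omega R k.+2 m n c t tau theta.

(** The scalar product of [alpha] and [X], with bounded durations. *)
Let Z (alpha : 'rV[R]_m) w : R :=
  c * \sum_(j < n.+1) duration t j (tau w) * direction (coord_ext alpha) (theta j w).

Let mZ alpha : measurable_fun setT (Z alpha).
Proof.
apply: measurable_funM => //; apply: measurable_sum => j; apply: measurable_funM.
  exact: measurableT_comp (@measurable_duration R n t j) (@measurable_funPT _ _ _ _ tau).
exact: measurableT_comp (measurable_direction _) (@measurable_funPT _ _ _ _ (theta j)).
Qed.

Let bZ alpha : bounded_by (Z alpha).
Proof.
apply: bounded_byM; first exact: bounded_by_cst.
apply: bounded_by_sum => j; apply: bounded_byM.
  exact: (bounded_by_comp tau (bounded_duration t0 j)).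
exact: (bounded_by_comp (theta j) (@bounded_direction_tuple R k _)).
Qed.

Let Z_moment alpha N : \int[P]_w Z alpha w ^+ N =
  (c * t) ^+ N * mom h (enorm alpha ^+ 2) N.
Proof.
rewrite enorm_sqr /dot.
have -> : \sum_(i < m) alpha 0 i * alpha 0 i = \sum_(i < k.+1) coord_ext alpha i ^+ 2.
  rewrite (@sum_coord_ext _ _ _ alpha (fun _ x => x ^+ 2) mk) => [|i]; last by rewrite expr0n.
  by apply: eq_bigr => i _; rewrite expr2.
rewrite exprMn -mulrA -(flight_moment nu0 t0 hf) -RintegralZl//.
  by apply: eq_Rintegral => w _; rewrite /Z exprMn.
have iZ : P.-integrable setT (EFin \o (fun w => c ^- N * Z alpha w ^+ N)).
  apply: bounded_integrable.
    by apply: measurable_funM => //; exact: measurable_funX.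
  by apply: bounded_byM; [exact: bounded_by_cst|exact: bounded_byX].
move: iZ; congr (_.-integrable _ _); apply/funext => w /=; congr EFin.
by rewrite /Z exprMn mulKf// expf_neq0// gt_eqF.
Qed.

(** The same with the true durations: [Y] and [Z] agree on the simplex, that is
    almost surely. *)
Let Y (alpha : 'rV[R]_m) w : R :=
  c * \sum_(j < n.+1) tnth (durations t (tau w)) j * direction (coord_ext alpha) (theta j w).

Let dotE alpha w : dot alpha (X w) = Y alpha w.
Proof.
rewrite /dot /Y /X /flight_projection.
under eq_bigr => i _ do rewrite mxE mulrCA mulr_sumr.
rewrite -mulr_sumr exchange_big /=; congr (c * _); apply: eq_bigr => j _.
rewrite directionE size_tuple mulr_sumr.
rewrite (@sum_coord_ext _ _ _ alpha (fun i x => tnth (durations t (tau w)) j *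
  (x * ((\prod_(l < i) sin (theta j w)`_l) * cos (theta j w)`_i))) mk).
  by apply: eq_bigr => i _; ring.
by move=> i; rewrite mul0r mulr0.
Qed.

Let mY alpha : measurable_fun setT (Y alpha).
Proof.
apply: measurable_funM => //; apply: measurable_sum => j; apply: measurable_funM.
  exact: measurableT_comp (@measurable_durations R n t j) (@measurable_funPT _ _ _ _ tau).
exact: measurableT_comp (measurable_direction _) (@measurable_funPT _ _ _ _ (theta j)).
Qed.

Let expectE alpha (g : R -> R) : measurable_fun setT g ->
  fine 'E_P[fun w => g (dot alpha (X w))] = \int[P]_w g (Z alpha w).
Proof.
move=> mg; rewrite (_ : (fun w => g (dot alpha (X w))) = (fun w => g (Y alpha w))).
  rewrite unlock /Rintegral; congr fine.
  apply: ae_eq_integral => //.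
  - by apply/measurable_EFinP; exact: measurableT_comp mg (mY alpha).
  - by apply/measurable_EFinP; exact: measurableT_comp mg (mZ alpha).
  have mS : measurable (tau @^-1` [set s | in_simplex t s]).
    rewrite (_ : _ @^-1` _ = (fun w => in_simplex t (tau w)) @^-1` [set true]).
      rewrite -[_ @^-1` _]setTI.
      exact: (measurableT_comp (@measurable_in_simplex R n t) (@measurable_funPT _ _ _ _ tau)).
    by apply/seteqP; split => w.
  exists (~` (tau @^-1` [set s | in_simplex t s])); split.
  - exact: measurableC.
  - by apply: (etrans (probability_setC P mS)); rewrite (ae_in_simplex t0 hf) subee.
  - apply: subsetC => w /= tw _; rewrite /Y /Z; congr (g (c * _))%:E.
    by apply: eq_bigr => j _; rewrite /duration tw.
by apply/funext => w; rewrite dotE.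
Qed.

Lemma charfunE alpha : charfun P X alpha = (\int[P]_w cos (Z alpha w))%:C%C.
Proof.
rewrite /charfun /cexpectation /=.
rewrite (expectE alpha measurable_cos) (expectE alpha measurable_sin).
rewrite (expect_sin_odd (mZ alpha) (bZ alpha))// => N oN.
by rewrite Z_moment mom_odd// mulr0.
Qed.

Lemma flight_charfunE alpha : alpha != 0 ->
  flight_charfun k.+2 n nu c t (enorm alpha) = \int[P]_w cos (Z alpha w).
Proof.
move=> a0; rewrite /flight_charfun -/a.
set s := n.+1%:R / 2 * a.
have hE : s + 1 / 2 = h by rewrite /s /h; field.
have -> : s - 1 / 2 = h - 1 by rewrite -hE; field.
rewrite hE.
have x0 : 0 < c * t * enorm alpha by rewrite !mulr_gt0// enorm_gt0.
set x := c * t * enorm alpha in x0 *.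
rewrite (@besselJE _ h x (\int[P]_w cos (Z alpha w)))//; last first.
  have := @expect_cos_series _ _ _ P _ (mZ alpha) (bZ alpha).
  rewrite (_ : (fun k0 : nat => (-1) ^+ k0 *
      (\int[P]_w Z alpha w ^+ k0.*2 / k0.*2`!%:R)) = (fun k0 => (-1) ^+ k0 *
    (x ^+ k0.*2 * (poch (1 / 2) k0 / poch h k0) / k0.*2`!%:R)))//.
  apply/funext => i; rewrite Z_moment mom_double -exprM mul2n /x.
  by rewrite [in RHS]exprMn; ring.
have -> : (x / 2) `^ (h - 1) = x `^ (h - 1) / 2 `^ (h - 1).
  rewrite (@powRM R x 2^-1) ?(ltW x0)//; congr (_ * _).
  by rewrite -(@powR_inv1 _ 2)// -powRrM mulN1r powRN.
have G0 : Gamma h != 0 by rewrite gt_eqF// Gamma_gt0.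
have px : x `^ (h - 1) != 0 by rewrite powR_eq0 gt_eqF.
have p2 : (2 : R) `^ (h - 1) != 0 by rewrite powR_eq0 gt_eqF.
by field; rewrite px G0 p2.
Qed.

Lemma cvg_flight_charfun :
  flight_charfun k.+2 n nu c t (enorm beta) @[beta --> (0 : 'rV[R]_m)^'] --> (1 : R).
Proof.
(* [C * dot beta beta] is the second moment of the projection on [beta]. *)
pose C := (c * t) ^+ 2 * (poch (1 / 2) 1 / poch h 1).
apply: (@squeeze_cvgr _ _ _ _ (fun beta : 'rV[R]_m => 1 - C * dot beta beta) (cst 1)).
- near=> beta.
  have b0 : beta != 0 by near: beta; exact: nbhs_dnbhs_neq.
  rewrite flight_charfunE//; apply/andP; split.
    have iZ2 : P.-integrable setT (EFin \o (fun w => Z beta w ^+ 2)).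
      by apply: bounded_integrable; [exact: measurable_funX|exact: bounded_byX].
    have i1 : P.-integrable setT (EFin \o (fun=> 1 : R)).
      by apply: bounded_integrable => //; exact: bounded_by_cst.
    have icos : P.-integrable setT (EFin \o (fun w => cos (Z beta w))).
      apply: bounded_integrable; first exact: measurableT_comp measurable_cos (mZ beta).
      by exists 1 => w; exact: cos_max.
    have -> : C * dot beta beta = \int[P]_w (Z beta w ^+ 2).
      by rewrite Z_moment (mom_double _ _ 1) expr1 enorm_sqr /C; ring.
    have {1}-> : 1 = \int[P]_w (1 : R) by rewrite Rintegral_cst//= probability_setT mulr1.
    rewrite -RintegralB//; apply: le_Rintegral => //.
      by apply: eq_integrable (integrableB measurableT i1 iZ2).
    by move=> w _; exact: cos_ge1Bsqr.
  have E1 : 1 = \int[P]_w (1 : R) by rewrite Rintegral_cst//= probability_setT mulr1.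
  rewrite [leRHS]E1; apply: le_Rintegral => //.
  + apply: bounded_integrable; first exact: measurableT_comp measurable_cos (mZ beta).
    by exists 1 => w; exact: cos_max.
  + by apply: bounded_integrable => //; exact: bounded_by_cst.
- have D0 : dot (0 : 'rV[R]_m) 0 = 0 by rewrite /dot big1// => i _; rewrite mxE mul0r.
  have : 1 - C * dot beta beta @[beta --> (0 : 'rV[R]_m)] --> 1 - C * dot (0 : 'rV[R]_m) 0.
    have F0 : Filter (nbhs (0 : 'rV[R]_m)) by exact: nbhs_filter.
    apply: (@cvgB _ R^o); first exact: (@cvg_cst R 1 _ (nbhs (0 : 'rV[R]_m)) F0).
    apply: cvgM; last exact: cvg_dot.
    exact: (@cvg_cst R C _ (nbhs (0 : 'rV[R]_m)) F0).
  by rewrite D0 mulr0 subr0 => H A HA; exact: (nbhs_dnbhs (H A HA)).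
- exact: cvg_cst.
Unshelve. all: by end_near. Qed.

End flight.

Theorem theorem1 (R : realType) (d m n : nat) (nu c t : R)
    (hd : (2 <= d)%N) (hm : (1 <= m)%N) (hmd : (m < d)%N) (hn : (1 <= n)%N)
    (hnu : 0 <= nu) (hc : 0 < c) (ht : 0 < t)
    (disp : measure_display) (Omega : measurableType disp)
    (P : probability Omega R)
    (tau : {RV P >-> n.-tuple R})
    (theta : 'I_n.+1 -> {RV P >-> (d.-1).-tuple R})
    (hflight : random_flight nu t tau theta) :
  let X : Omega -> 'rV[R]_m := @flight_projection Omega R d m n c t tau theta in
  let F : 'rV[R]_m -> R := fun alpha => flight_charfun d n nu c t (enorm alpha) in
  forall alpha : 'rV[R]_m,
    (alpha != 0 -> charfun P X alpha = (F alpha)%:C%C) /\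
    (alpha = 0 -> exists2 l : R,
       F beta @[beta --> (0 : 'rV[R]_m)^'] --> l & charfun P X alpha = l%:C%C).
Proof.
case: d hd hmd theta hflight => [//|[//|k]] _ mk theta hf X F alpha.
have {}mk : (m <= k.+1)%N := mk.
have E := @charfunE _ _ _ _ _ _ _ _ c _ _ _ mk hnu hc ht hf alpha.
split=> [a0|->].
  by rewrite /F (@flight_charfunE _ _ _ _ _ _ _ _ c _ _ _ mk hnu hc ht hf alpha a0).
exists 1; first exact: (@cvg_flight_charfun _ _ _ _ _ _ _ _ c _ _ _ mk hnu hc ht hf).
rewrite /charfun /cexpectation unlock /=.
have D w : dot (0 : 'rV[R]_m) (X w) = 0.
  by rewrite /dot big1// => i _; rewrite mxE mul0r.
under eq_integral do rewrite D cos0.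
under [X in Complex _ (fine X)]eq_integral do rewrite D sin0.
rewrite integral_cst//= probability_setT mule1 integral0.
by [].
Qed.
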